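(* Let $G$ be a bipartite graph without isolated vertices and let $g={\rm ht}\, I(G)$. Then $G$ is Cohen-Macaulay if and only if the following two conditions hold: ($\mathrm{h}_1'$) $\Delta_G^{[g]}$ is shellable, and ($\mathrm{h}_2'$) $G$ is unmixed.
   Context: Graphs are finite and simple. Let $R$ be the polynomial ring over a field $K$ whose variables are the vertices of $G$. The edge ideal $I(G)\subset R$ is generated by the monomials $xy$ with $\{x,y\}\in E(G)$; its height ${\rm ht}\, I(G)$ equals the minimum size of a vertex cover of $G$ (a set of vertices meeting every edge). $G$ is Cohen-Macaulay if $R/I(G)$ is Cohen-Macaulay. $G$ is unmixed if all its minimal vertex covers (with respect to inclusion) have the same size. $\Delta_G$ is the simplicial complex on the vertex set of $G$ whose faces are the independent sets of vertices of $G$. For $0\leq k\leq\dim(\Delta_G)+1$, $\Delta_G^{[k]}=\langle\{F\in\Delta_G : |F|=k\}\rangle$ is the subcomplex of $\Delta_G$ generated by the faces with exactly $k$ elements. A simplicial complex $\Delta$ is shellable if its facets can be ordered $F_1,\ldots,F_s$ such that for all $1\leq i<j\leq s$ there exist $v\in F_j\setminus F_i$ and $\ell\in\{1,\ldots,j-1\}$ with $F_j\setminus F_\ell=\{v\}$. *)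

(* Defs.v *)
From HB Require Import structures.
From mathcomp Require Import all_boot all_order all_algebra.
From mathcomp Require Import ring_quotient.
From mathcomp Require Import boolp mpoly.

Set Implicit Arguments.
Unset Strict Implicit.
Unset Printing Implicit Defensive.

Import GRing.Theory.
Local Open Scope ring_scope.

Definition is_max (Q : nat -> Prop) (d : nat) : Prop :=
  Q d /\ forall k, Q k -> (k <= d)%N.

Section CommutativeAlgebra.
Variable A : comNzRingType.
Implicit Types I J P M : {pred A}.

Definition ideal_gen (S : {pred A}) : {pred A} := fun x =>
  `[< exists (n : nat) (a b : 'I_n -> A),
        (forall i, b i \in S) /\ x = \sum_i a i * b i >].

(* [idealr_closed] includes properness: it requires 1 \notin P. *)
Definition prime_ideal P : Prop := idealr_closed P /\ prime_idealr_closed P.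

Definition maximal_ideal M : Prop :=
  idealr_closed M /\
  forall J, idealr_closed J -> {subset M <= J} -> {subset J <= M}.

(* P is the top of a chain of primes P_0 < P_1 < ... < P_k = P. *)
Definition prime_chain_to P (k : nat) : Prop :=
  exists c : nat -> {pred A},
    [/\ forall i, (i <= k)%N -> prime_ideal (c i),
        forall i, (i < k)%N ->
          {subset c i <= c i.+1} /\ ~ {subset c i.+1 <= c i}
      & c k =i P].

Definition prime_height P (h : nat) : Prop := is_max (prime_chain_to P) h.

Definition ideal_height I (h : nat) : Prop :=
  (exists P, [/\ prime_ideal P, {subset I <= P} & prime_height P h]) /\
  (forall P, prime_ideal P -> {subset I <= P} -> prime_chain_to P h).

Definition regular_seq (s : seq A) : Prop :=
  (forall (i : nat) (x : A), (i < size s)%N ->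
     s`_i * x \in ideal_gen (mem (take i s)) ->
     x \in ideal_gen (mem (take i s))) /\
  1 \notin ideal_gen (mem s).

Definition depth_in I (d : nat) : Prop :=
  is_max (fun k => exists s : seq A,
    [/\ size s = k, regular_seq s & {subset s <= I}]) d.

(* The usual definition for Noetherian A: depth and height of M are the depth
   and dimension of A_M. No chain condition is imposed, since it is applied
   only to the (Noetherian) quotient of a polynomial ring over a field. *)
Definition Cohen_Macaulay : Prop :=
  forall M, maximal_ideal M ->
    exists d : nat, prime_height M d /\ depth_in M d.

Lemma ideal_gen_closed (S : {pred A}) :
  1 \notin ideal_gen S -> idealr_closed (ideal_gen S).
Proof.
move=> S1; split=> //.
  apply/asboolP; exists 0%N, (fun=> 0), (fun=> 0).
  by split=> [[]|] //; rewrite big_ord0.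
move=> a u v /asboolP[n [c [b [Sb ->]]]] /asboolP[m [d [b' [Sb' ->]]]].
apply/asboolP; exists (n + m)%N.
exists (fun i => match split i with inl j => a * c j | inr j => d j end).
exists (fun i => match split i with inl j => b j | inr j => b' j end).
split=> [i|]; first by case: (split i).
rewrite big_split_ord /= mulr_sumr; congr (_ + _); apply: eq_bigr => i _.
  by rewrite (unsplitK (inl i)) mulrA.
by rewrite (unsplitK (inr i)).
Qed.

End CommutativeAlgebra.

Section EdgeIdeal.
Variables (K : fieldType) (T : finType) (e : rel T).

Definition vertex_var (x : T) : {mpoly K[#|T|]} := 'X_(enum_rank x).

Definition edge_monomials : {pred {mpoly K[#|T|]}} :=
  [pred p | [exists x, exists y, e x y && (p == vertex_var x * vertex_var y)]].

Definition edge_ideal : {pred {mpoly K[#|T|]}} := ideal_gen edge_monomials.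

Lemma edge_ideal_closed : idealr_closed edge_ideal.
Proof.
apply: ideal_gen_closed; apply/negP => /asboolP[n [a [b [Sb /eqP]]]].
apply/negP; apply/eqP => /(congr1 (meval (fun=> 0))); rewrite meval1 raddf_sum.
rewrite big1 => [/eqP|i _ /=]; first by rewrite oner_eq0.
have /existsP[x /existsP[y /andP[_ /eqP->]]] := Sb i.
by rewrite !mevalM !mevalXU !mulr0.
Qed.

HB.instance Definition _ :=
  isIdealr.Build {mpoly K[#|T|]} edge_ideal edge_ideal_closed.

Definition edge_ring : comNzRingType := {ideal_quot edge_ideal}.

Definition CM_graph : Prop := Cohen_Macaulay edge_ring.

End EdgeIdeal.

Arguments edge_ideal K {T} e _.
Arguments edge_ring K {T} e.
Arguments CM_graph K {T} e.

Section GraphsAndComplexes.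
Variable T : finType.
Implicit Types (e : rel T) (D : {set {set T}}).

Definition bipartite e : Prop :=
  exists A : {set T}, forall x y, e x y -> (x \in A) != (y \in A).

Definition no_isolated e : Prop := forall x, exists y, e x y.

Definition vertex_cover e (C : {set T}) : bool :=
  [forall x, forall y, e x y ==> (x \in C) || (y \in C)].

Definition unmixed e : Prop :=
  forall C C' : {set T},
    minset (vertex_cover e) C -> minset (vertex_cover e) C' -> #|C| = #|C'|.

Definition independent e (F : {set T}) : bool :=
  [forall x in F, forall y in F, ~~ e x y].

Definition indep_complex e : {set {set T}} := [set F | independent e F].

Definition pure_skeleton D (k : nat) : {set {set T}} :=
  [set F : {set T} | [exists H in D, (#|H| == k) && (F \subset H)]].

Definition facets D : {set {set T}} :=
  [set F | maxset (fun H => H \in D) F].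

Definition shellable D : Prop :=
  exists s : seq {set T},
    [/\ uniq s, s =i facets D
      & forall i j, (i < j)%N -> (j < size s)%N ->
          exists2 v, v \in nth set0 s j :\: nth set0 s i &
          exists2 l, (l < j)%N & nth set0 s j :\: nth set0 s l = [set v]].

End GraphsAndComplexes.

(* Main.v *)
From HB Require Import structures.
Require Import Defs.
From mathcomp Require Import all_boot all_order all_algebra.
From mathcomp Require Import ring_quotient mpoly boolp.
From mathcomp Require classical_sets.
From mathcomp Require Import ring.

(** In an unmixed bipartite graph without isolated vertices all facets of the
    independence complex have [g] elements, so the skeleton of the statement is the
    whole complex.  Hence the theorem says that Cohen-Macaulay graphs are unmixed and
    that, for unmixed [G], Cohen-Macaulay and shellable are equivalent.

    Combinatorics.  Let [A] be one side of an unmixed bipartite graph.  By Hall's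
    theorem there is a perfect matching [a |-> f a] of [A] with the other side
    ([perfect_matching]).  A facet contains exactly one of [a] and [f a]
    ([facet_match]), the relation [e a (f b)] is a preorder on [A] ([match_trans]), and
    facets correspond to its up-sets.  When the preorder is antisymmetric, listing the
    up-sets by increasing size gives a shelling ([facets_shelling]).

    From Cohen-Macaulay to shellable.  In a Cohen-Macaulay complex, every link of
    positive dimension is connected.  This is Hartshorne's connectedness argument
    ([CM_link_connected]), made in terms of the maximal ideal [M] of the point that is
    1 on a face [F] and 0 elsewhere: a disconnection of the link gives an explicit
    cocycle of degree [#|F|.+1] in a Koszul complex of [M], whereas a long regular
    sequence in [M] forces the cohomology to vanish in that degree
    ([regular_wedge_exact]).  Two facets of different sizes produce a disconnected
    link ([CM_unmixed]), and so do two equivalent elements of the preorder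
    ([CM_match_antisymmetric]).

    From shellable to Cohen-Macaulay.  On each facet [var a + var (f a)] restricts to
    one of the variables.  Given a maximal ideal [M] of the edge ring, Zariski's lemma
    ([zariski_gdomain]) provides nonzero polynomials [pp a] such that the values of
    [pp a] at [var a + var (f a)] lie in [M].  These values form a regular sequence in
    the coordinate ring of each facet ([facet_weakly_regular]), hence in the edge ring,
    because the shelling filters it with quotients isomorphic to these coordinate rings
    ([shelling_weakly_regular]).  So the depth at [M] is at least [#|A|]; the height is
    at least the length of any regular sequence ([regular_seq_prime_chain]), by Krull's
    construction of primes avoiding a multiplicative set.  Conversely, both regular
    sequences and strict chains of primes yield algebraically independent elements
    ([chain_independent]), of which the edge ring has at most [#|A|]
    ([edge_ring_dim]).

    The last ingredient is the computation of the height of the edge ideal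
    ([edge_ideal_height]), which identifies [g] with [#|A|]. *)

Set Implicit Arguments.
Unset Strict Implicit.
Unset Printing Implicit Defensive.

Import GRing.Theory.
Local Open Scope ring_scope.

(** * Ideals and regular sequences *)

Section Ideals.
Variable A : comNzRingType.
Implicit Types (I M P Q S : {pred A}) (s : seq A).

(** Unlike [idealr_closed], this allows the unit ideal, so that it holds for
    every [ideal_gen]. *)
Definition ideal_closed I : Prop :=
  0 \in I /\ forall a u v, u \in I -> v \in I -> a * u + v \in I.

Lemma idealr_ideal_closed I : idealr_closed I -> ideal_closed I.
Proof. by case=> I0 _ h; split=> // a u v; apply: h. Qed.

Section Closure.
Variable I : {pred A}.
Hypothesis hI : ideal_closed I.

Lemma ideal0 : 0 \in I. Proof. by case: hI. Qed.

Lemma idealD u v : u \in I -> v \in I -> u + v \in I.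
Proof. by move=> Iu Iv; rewrite -[u]mul1r; case: hI => _; apply. Qed.

Lemma idealM a u : u \in I -> a * u \in I.
Proof. by move=> Iu; rewrite -[a * u]addr0; case: hI => I0; apply. Qed.

Lemma idealB u v : u \in I -> v \in I -> u - v \in I.
Proof. by move=> Iu Iv; apply: idealD => //; rewrite -mulN1r; apply: idealM. Qed.

Lemma ideal_sum (T : Type) (r : seq T) (p : pred T) (F : T -> A) :
  (forall i, p i -> F i \in I) -> \sum_(i <- r | p i) F i \in I.
Proof. by apply: (big_ind (fun x => x \in I)); [exact: ideal0 | exact: idealD]. Qed.

End Closure.

Lemma mem_ideal_gen S x : x \in S -> x \in ideal_gen S.
Proof.
move=> Sx; apply/asboolP; exists 1%N, (fun=> 1), (fun=> x).
by rewrite big_ord1 mul1r.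
Qed.

Lemma ideal_gen_min S I : ideal_closed I -> {subset S <= I} ->
  {subset ideal_gen S <= I}.
Proof.
move=> hI sSI x /asboolP[n [a [b [Sb ->]]]].
by apply: ideal_sum => // i _; apply: idealM => //; apply: sSI.
Qed.

Lemma ideal_gen_ideal S : ideal_closed (ideal_gen S).
Proof.
have [/asboolP[n [a [b [Sb e1]]]]|] := boolP (1 \in ideal_gen S); last first.
  by move=> /ideal_gen_closed; apply: idealr_ideal_closed.
suff all x : x \in ideal_gen S by split.
apply/asboolP; exists n, (fun i => x * a i), b; split=> //.
by rewrite -[LHS]mulr1 e1 mulr_sumr; apply: eq_bigr => i _; rewrite mulrA.
Qed.

Lemma prime_idealP P u v : prime_ideal P -> u * v \in P -> u \notin P -> v \in P.
Proof. by case=> _ pP /pP /orP[->|]. Qed.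

Lemma maximal_inverse M u : maximal_ideal M -> u \notin M ->
  exists a, 1 - a * u \in M.
Proof.
move=> [idM maxM] Mu; have hM := idealr_ideal_closed idM.
pose J : {pred A} := fun x : A => `[< exists a, x - a * u \in M >].
have [|J1] := boolP (1 \in J); first by move/asboolP.
case/negP: Mu; apply: (maxM J).
- split=> //; first by apply/asboolP; exists 0; rewrite mul0r subr0 ideal0.
  move=> a x y /asboolP[b Mb] /asboolP[c Mc]; apply/asboolP; exists (a * b + c).
  have -> : a * x + y - (a * b + c) * u = a * (x - b * u) + (y - c * u) by ring.
  by apply: idealD => //; apply: idealM.
- by move=> x Mx; apply/asboolP; exists 0; rewrite mul0r subr0.
by apply/asboolP; exists 1; rewrite mul1r subrr ideal0.
Qed.

Lemma maximal_prime M : maximal_ideal M -> prime_ideal M.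
Proof.
move=> mM; have [idM _] := mM; have hM := idealr_ideal_closed idM.
split=> // u v Muv; have [//|Mu] := boolP (u \in M) => /=.
have [a Ma] := maximal_inverse mM Mu.
have -> : v = v * (1 - a * u) + a * (u * v) by ring.
by apply: idealD => //; apply: idealM.
Qed.

Lemma ideal_gen_takeS s i x : (i < size s)%N ->
  x \in ideal_gen (mem (take i.+1 s)) ->
  exists v, x - v * s`_i \in ideal_gen (mem (take i s)).
Proof.
move=> lis; set Q := ideal_gen _; set Q' := ideal_gen (mem (take i s)).
have hQ' : ideal_closed Q' by apply: ideal_gen_ideal.
pose J : {pred A} := fun x : A => `[< exists v, x - v * s`_i \in Q' >].
suff sub : {subset Q <= J} by move=> /sub /asboolP.
apply: ideal_gen_min.
  split; first by apply/asboolP; exists 0; rewrite mul0r subrr ideal0.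
  move=> a u v /asboolP[b hb] /asboolP[c hc]; apply/asboolP; exists (a * b + c).
  have -> : a * u + v - (a * b + c) * s`_i
            = a * (u - b * s`_i) + (v - c * s`_i) by ring.
  by apply: idealD => //; apply: idealM.
move=> y /=; rewrite (take_nth 0 lis) mem_rcons inE => /orP[/eqP->|y_in].
  by apply/asboolP; exists 1; rewrite mul1r subrr ideal0.
by apply/asboolP; exists 0; rewrite mul0r subr0 mem_ideal_gen.
Qed.

Lemma ideal_gen_take_sub s i : {subset ideal_gen (mem (take i s)) <=
                                       ideal_gen (mem (take i.+1 s))}.
Proof.
apply: ideal_gen_min; first exact: ideal_gen_ideal.
move=> x /= xs; apply: mem_ideal_gen => /=.
by move: xs; rewrite -(take_takel s (leqnSn i)) => /mem_take.
Qed.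

Lemma nth_ideal_gen s i : (i < size s)%N -> s`_i \in ideal_gen (mem (take i.+1 s)).
Proof.
by move=> lis; apply: mem_ideal_gen; rewrite /= (take_nth 0 lis) mem_rcons mem_head.
Qed.

Lemma ideal_gen_take_sumP s i x : (i <= size s)%N ->
  reflect (exists a : nat -> A, x = \sum_(j < i) a j * s`_j)
          (x \in ideal_gen (mem (take i s))).
Proof.
move=> lis; apply: (iffP idP); last first.
  move=> [a ->]; apply: ideal_sum => [|j _]; first exact: ideal_gen_ideal.
  apply: idealM; first exact: ideal_gen_ideal.
  apply: mem_ideal_gen => /=.
  by rewrite -(nth_take 0 (ltn_ord j)) mem_nth // size_takel.
elim: i x lis => [|i IH] x lis.
  rewrite take0 => /asboolP[[|n] [a [b [Sb ->]]]]; last by have := Sb ord0.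
  by exists (fun=> 0); rewrite !big_ord0.
case/(ideal_gen_takeS lis) => v /IH[|a xE]; first exact: ltnW.
exists (fun j => if j == i then v else a j); rewrite big_ord_recr /= eqxx.
rewrite -[x](subrK (v * s`_i)) xE; congr (_ + _); apply: eq_bigr => j _.
by rewrite ltn_eqF.
Qed.

End Ideals.

(** * Prime chains *)

Lemma prime_chain_to_eq (A : comNzRingType) (P Q : {pred A}) k :
  P =i Q -> prime_chain_to P k -> prime_chain_to Q k.
Proof. by move=> PQ [c [c1 c2 c3]]; exists c; split=> // x; rewrite c3 PQ. Qed.

Lemma prime_chain0 (A : comNzRingType) (P : {pred A}) :
  prime_ideal P -> prime_chain_to P 0.
Proof. by move=> pP; exists (fun=> P); split. Qed.

Lemma prime_chain_snoc (A : comNzRingType) (P Q : {pred A}) k :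
  prime_chain_to P k -> prime_ideal Q -> {subset P <= Q} -> ~ {subset Q <= P} ->
  prime_chain_to Q k.+1.
Proof.
move=> [c [c1 c2 c3]] pQ PQ nQP; exists (fun i => if (i <= k)%N then c i else Q); split.
- by move=> i _; case: ifP => // ik; apply: c1.
- move=> i; rewrite ltnS => ik; rewrite ik; case: ltnP => [ltik|leki]; first exact: c2.
  have -> : i = k by apply/eqP; rewrite eqn_leq ik.
  split=> [x|sub]; first by rewrite c3; apply: PQ.
  by apply: nQP => x /sub; rewrite c3.
by rewrite ltnn.
Qed.

Section Krull.
Variable A : comNzRingType.

(** Krull's lemma: an ideal that is maximal among those avoiding a
    multiplicative set is prime; Zorn's lemma provides one. *)
Lemma prime_avoiding (Q : {pred A}) (S : A -> Prop) :
  ideal_closed Q -> S 1 -> (forall x y, S x -> S y -> S (x * y)) ->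
  (forall x, S x -> x \notin Q) ->
  exists P : {pred A},
    [/\ prime_ideal P, {subset Q <= P} & forall x, S x -> x \notin P].
Proof.
move=> hQ S1 SM SQ.
(* The family is made of the sets X for which the union of Q and X is such an
   ideal, so that the empty chain has an upper bound. *)
pose ext (X : A -> Prop) : {pred A} := fun x : A => (x \in Q) || `[< X x >].
have [F Fne tot|X [[hX dX] maxX]] := @classical_sets.Zorn_bigcup A
    (fun X => ideal_closed (ext X) /\ forall x, S x -> x \notin ext X).
- set U := classical_sets.bigcup _ _.
  have inU X x : F X -> x \in ext X -> x \in ext U.
    move=> FX /orP[Qx|/asboolP Xx]; apply/orP; [by left|right].
    by apply/asboolP; exists X.
  have extU x : x \in ext U -> x \in Q \/ exists2 X, F X & x \in ext X.
    case/orP=> [|/asboolP[X FX Xx]]; [by left|right; exists X => //].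
    by apply/orP; right; apply/asboolP.
  have sub X Y x : classical_sets.subset X Y -> x \in ext X -> x \in ext Y.
    move=> XY /orP[Qx|/asboolP /XY Yx]; apply/orP; [by left|right].
    exact/asboolP.
  have inQ X x : x \in Q -> x \in ext X by move=> Qx; apply/orP; left.
  split; last first.
    move=> x Sx; apply/negP => /extU[|[X FX]]; first by move/negP: (SQ x Sx).
    by case: (Fne X FX) => _ /(_ x Sx) /negP.
  split; first by apply: inQ; apply: ideal0.
  move=> a u v /extU[Qu|[X FX Xu]] /extU[Qv|[Y FY Yv]].
  + by apply: inQ; case: hQ => _; apply.
  + by apply: (inU Y) => //; case: (Fne Y FY) => -[_ hY] _; apply: hY => //; apply: inQ.
  + by apply: (inU X) => //; case: (Fne X FX) => -[_ hX] _; apply: hX => //; apply: inQ.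
  have [XY|YX] := tot X Y FX FY.
  + by apply: (inU Y) => //; case: (Fne Y FY) => -[_ hY] _; apply: hY => //; apply: sub Xu.
  by apply: (inU X) => //; case: (Fne X FX) => -[_ hX] _; apply: hX => //; apply: sub Yv.
set P := ext X in hX dX.
have QP : {subset Q <= P} by move=> x Qx; apply/orP; left.
(* The ideal P + (u) properly contains P when u is not in P, so it meets S. *)
have meet u : u \notin P -> exists2 s, S s & exists a, s - a * u \in P.
  move=> Pu; apply: contrapT => noS.
  pose J (x : A) := exists a, x - a * u \in P.
  have JP x : x \in P -> J x by move=> Px; exists 0; rewrite mul0r subr0.
  have extJ x : x \in ext J <-> J x.
    split; last by move=> Jx; apply/orP; right; apply/asboolP.
    by case/orP => [/QP/JP|/asboolP].
  case: (maxX J).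
    split; first by move=> x Xx; apply: JP; apply/orP; right; apply/asboolP.
    move=> JX; case/negP: Pu; apply/orP; right; apply/asboolP; apply: JX.
    by exists 1; rewrite mul1r subrr (ideal0 hX).
  split; last first.
    by move=> x Sx; apply/negP => /extJ Jx; apply: noS; exists x.
  split; first by apply/extJ; apply: JP; apply: ideal0.
  move=> a x y /extJ[b hb] /extJ[c hc]; apply/extJ; exists (a * b + c).
  have -> : a * x + y - (a * b + c) * u = a * (x - b * u) + (y - c * u) by ring.
  by apply: idealD => //; apply: idealM.
exists P; split=> //; split.
  split; [exact: ideal0 | exact: dX | by case: hX].
move=> u v Puv; apply/orP; apply: contrapT => /not_orP[/negP Pu /negP Pv].
have [s Ss [a hs]] := meet u Pu; have [t St [b ht]] := meet v Pv.
case/negP: (dX _ (SM _ _ Ss St)).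
have -> : s * t = t * (s - a * u) + (a * u) * (t - b * v) + (a * b) * (u * v) by ring.
by do 2?[apply: idealD => //]; apply: idealM.
Qed.

(** If [s_1, ..., s_k] is regular in a prime [P], primes [P_k = P],
    [P_(k-1)], ... can be chosen downwards with [P_(i-1)] above
    [(s_1, ..., s_(i-1))] and avoiding the multiplicative set of all [u * s_i ^+ n]
    with [u] outside [P_i]: regularity of [s_i] is what keeps this set away from
    [(s_1, ..., s_(i-1))].  So depth is at most height. *)
Lemma regular_seq_prime_chain (P : {pred A}) (s : seq A) :
  prime_ideal P -> regular_seq s -> {subset s <= P} ->
  prime_chain_to P (size s).
Proof.
move=> pP [reg _] sP.
suff H i (R : {pred A}) : (i <= size s)%N -> prime_ideal R ->
    {subset ideal_gen (mem (take i s)) <= R} -> prime_chain_to R i.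
  apply: (H (size s) P) => //; apply: ideal_gen_min.
    by apply: idealr_ideal_closed; case: pP.
  by move=> x /= /mem_take /sP.
elim: i R => [|i IH] R lis pR sR; first exact: prime_chain0.
set Q := ideal_gen (mem (take i s)).
have QR : {subset Q <= R} by move=> x /ideal_gen_take_sub /sR.
have [R1 hR] : 1 \notin R /\ ideal_closed R.
  by case: pR => idR _; split; [case: idR | apply: idealr_ideal_closed].
pose S x := exists2 u, u \notin R & exists n, x = u * s`_i ^+ n.
have [| | | |R' [pR' QR' SR']] := @prime_avoiding Q S.
- exact: ideal_gen_ideal.
- by exists 1 => //; exists 0%N; rewrite mulr1.
- move=> _ _ [u Ru [n ->]] [v Rv [m ->]]; exists (u * v).
    by apply/negP => Ruv; case/negP: Rv; apply: prime_idealP Ruv Ru.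
  by exists (n + m)%N; rewrite exprD; ring.
- move=> _ [u Ru [n ->]]; apply/negP => Qu; case/negP: Ru; apply: QR.
  elim: n Qu => [|n IHn]; first by rewrite mulr1.
  by rewrite exprS mulrCA => /(reg i _ lis)/IHn.
apply: prime_chain_snoc (IH R' (ltnW lis) pR' QR') pR _ _ => [x R'x|sub].
  apply: contraLR R'x => Rx; apply: SR'; exists x => //.
  by exists 0%N; rewrite mulr1.
have : s`_i \in R' by apply/sub/sR/nth_ideal_gen.
by apply/negP/SR'; exists 1 => //; exists 1%N; rewrite mul1r.
Qed.

End Krull.

Section Monomials.
Variable A : comNzRingType.

(** An iterated product, so that the exponent of the first variable can be split
    off. *)
Fixpoint exponents (m k : nat) : finType :=
  if k is k'.+1 then ('I_m * exponents m k')%type else unit.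

Fixpoint monomial (m k : nat) (t : nat -> A) : exponents m k -> A :=
  match k with
  | 0 => fun=> 1
  | k'.+1 => fun u => t 0%N ^+ u.1 * @monomial m k' (fun j => t j.+1) u.2
  end.

Lemma card_exponents m k : #|exponents m k| = (m ^ k)%N.
Proof. by elim: k => [|k IH] /=; rewrite ?card_unit // card_prod card_ord IH expnS. Qed.

End Monomials.

Lemma rmorph_monomial (A B : comNzRingType) (f : {rmorphism A -> B}) m k t
    (u : exponents m k) : f (monomial t u) = monomial (fun j => f (t j)) u.
Proof.
elim: k t u => [|k IH] t u /=; first by rewrite rmorph1.
by rewrite rmorphM rmorphXn IH.
Qed.

(** Elements that advance step by step through a chain of ideals [Q_0, ..., Q_k],
    each a nonzerodivisor modulo the ideal it leaves, are algebraically
    independent over a field, even modulo [Q_0]: given a relation, cancel the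
    largest power of [t_0] dividing it and put [t_0 = 0]; this gives a nontrivial
    relation of [t_1, ...] modulo [Q_1], and in the end a nonzero constant in
    [Q_k].  It applies to regular sequences and to strict chains of primes. *)
Lemma chain_independent (K : fieldType) (A : comNzRingType)
    (f : {rmorphism K -> A}) (m k : nat) (Q : nat -> {pred A}) (t : nat -> A)
    (c : exponents m k -> K) :
  (forall i, (i <= k)%N -> idealr_closed (Q i)) ->
  (forall i, (i < k)%N -> [/\ {subset Q i <= Q i.+1}, t i \in Q i.+1 &
                              forall u, t i * u \in Q i -> u \in Q i]) ->
  (exists u, c u != 0) ->
  \sum_u f (c u) * monomial t u \notin Q 0%N.
Proof.
elim: k Q t c => [|k IH] Q t c idQ stepQ [u0 cu0].
  have idQ0 := idQ 0%N (leqnn _); have hQ0 := idealr_ideal_closed idQ0.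
  rewrite (big_pred1 u0) => [|[]]; last by case: u0 {cu0}.
  case: idQ0 => _ Q1 _; apply: contra Q1; rewrite mulr1 => /(idealM hQ0 (f (c u0)^-1)).
  by rewrite -rmorphM mulVf // rmorph1.
pose E (i : 'I_m) := \sum_v f (c (i, v)) * monomial (fun j => t j.+1) v.
have -> : \sum_u f (c u) * monomial t u = \sum_(i < m) t 0%N ^+ i * E i.
  under [RHS]eq_bigr do rewrite big_distrr; rewrite pair_bigA /=.
  by apply: eq_bigr => -[i v] _ /=; rewrite mulrCA.
have exi : [exists v, c (u0.1, v) != 0].
  by apply/existsP; exists u0.2; rewrite -surjective_pairing.
case: (@arg_minnP 'I_m u0.1 (fun i : 'I_m => [exists v, c (i, v) != 0])
  (@nat_of_ord m) exi) => i0 /existsP nz0 min0.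
have E0 (i : 'I_m) : (i < i0)%N -> E i = 0.
  move=> lti; rewrite /E big1 // => v _.
  have [->|nz] := eqVneq (c (i, v)) 0; first by rewrite rmorph0 mul0r.
  suff /min0 : [exists v, c (i, v) != 0] by rewrite leqNgt lti.
  by apply/existsP; exists v.
have -> : \sum_(i < m) t 0%N ^+ i * E i
    = t 0%N ^+ i0 * \sum_(i < m | (i0 <= i)%N) t 0%N ^+ (i - i0) * E i.
  rewrite (bigID (fun i : 'I_m => (i0 <= i)%N)) /= [X in _ + X]big1 ?addr0.
    by rewrite mulr_sumr; apply: eq_bigr => i le_i; rewrite mulrA -exprD subnKC.
  by move=> i; rewrite -ltnNge => /E0 ->; rewrite mulr0.
set W := \sum_(i < m | _) _; have [Q01 t01 reg0] := stepQ 0%N isT.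
apply/negP => QW; have {QW}/Q01 : W \in Q 0%N.
  elim: (nat_of_ord i0) QW => [|n IHn]; first by rewrite mul1r.
  by rewrite exprS -mulrA => /reg0.
have hQ1 : ideal_closed (Q 1%N) by apply: idealr_ideal_closed; apply: idQ.
move=> QW; suff : E i0 \in Q 1%N.
  apply/negP; apply: (IH (fun i => Q i.+1) _ (fun v => c (i0, v))) => // i lti.
    exact: idQ.
  exact: stepQ.
move: QW; rewrite /W (bigD1 i0) //= subnn mul1r => QE.
set W' := \sum_(i < m | _) _ in QE.
have QW' : W' \in Q 1%N.
  apply: ideal_sum => // i /andP[le_i ne_i]; rewrite mulrC; apply: idealM => //.
  rewrite -[(i - i0)%N]prednK; first by rewrite exprSr; apply: idealM.
  by rewrite subn_gt0 ltn_neqAle eq_sym ne_i.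
by rewrite -(addrK W' (E i0)); apply: idealB.
Qed.

(** * A Koszul complex of non-alternating cochains *)

Section Wedge.
Variables (A : comNzRingType) (J : finType).
Implicit Types (x y : J -> A) (c : seq J -> A) (s r : seq J).

(** A cochain of degree [i] is any function on the sequences of length [i],
    alternating or not, and [wedge y] is the signed shuffle with [y]:
    [(wedge y c) [j_0; ...; j_i]] is the sum over [l] of [(-1)^l * y j_l] times
    the value of [c] where [j_l] is left out.  For [y = x], this is the
    differential of a variant of the Koszul complex of [x].  All that is needed
    about it follows by induction from this recursion on sequences. *)
Fixpoint wedge y c s : A :=
  if s is j :: r then y j * c r - wedge y (fun r' => c (j :: r')) r else 0.

Lemma wedge_lin y (I : finType) (a : I -> A) (c : I -> seq J -> A) s :
  wedge y (fun r => \sum_i a i * c i r) s = \sum_i a i * wedge y (c i) s.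
Proof.
elim: s c => [|j s IH] c /=; first by rewrite big1 // => i _; rewrite mulr0.
rewrite IH mulr_sumr -sumrB; apply: eq_bigr => i _; ring.
Qed.

Lemma wedgeZ y a c s : wedge y (fun r => a * c r) s = a * wedge y c s.
Proof. by elim: s c => [|j s IH] c /=; rewrite ?mulr0 // IH; ring. Qed.

Lemma wedge_ideal (I : {pred A}) y c s : ideal_closed I ->
  (forall r, (size r).+1 = size s -> c r \in I) -> wedge y c s \in I.
Proof.
move=> hI; elim: s c => [|j s IH] c cI /=; first exact: ideal0.
apply: idealB => //; first by apply: idealM => //; apply: cI.
by apply: IH => r sr; apply: cI => /=; rewrite sr.
Qed.

Lemma eq_wedge y c1 c2 s : (forall r, (size r).+1 = size s -> c1 r = c2 r) ->
  wedge y c1 s = wedge y c2 s.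
Proof.
elim: s c1 c2 => [|j s IH] c1 c2 e12 //=; rewrite e12 //; congr (_ - _).
by apply: IH => r sr; apply: e12 => /=; rewrite sr.
Qed.

Lemma wedgeB y c1 c2 s :
  wedge y (fun r => c1 r - c2 r) s = wedge y c1 s - wedge y c2 s.
Proof. by elim: s c1 c2 => [|j s IH] c1 c2 /=; rewrite ?subr0 // IH; ring. Qed.

Lemma wedge_anticomm x y c s : wedge x (wedge y c) s = - wedge y (wedge x c) s.
Proof.
elim: s c => [|j s IH] c /=; first by rewrite oppr0.
by rewrite !wedgeB !wedgeZ IH; ring.
Qed.

Lemma wedge_twice y c s : wedge y (wedge y c) s = 0.
Proof.
elim: s c => [|j s IH] c //=.
by rewrite wedgeB wedgeZ IH subr0 subrr.
Qed.

Lemma wedge_lin_l (I : finType) (a : I -> A) (y : I -> J -> A) c s :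
  wedge (fun j => \sum_i a i * y i j) c s = \sum_i a i * wedge (y i) c s.
Proof.
elim: s c => [|j s IH] c /=; first by rewrite big1 // => i _; rewrite mulr0.
rewrite IH mulr_suml -sumrB; apply: eq_bigr => i _; ring.
Qed.

Lemma eq_wedge_l y1 y2 c s : y1 =1 y2 -> wedge y1 c s = wedge y2 c s.
Proof. by move=> e12; elim: s c => [|j s IH] c //=; rewrite e12 IH. Qed.

Lemma wedgeD_l y1 y2 c s :
  wedge (fun j => y1 j + y2 j) c s = wedge y1 c s + wedge y2 c s.
Proof. by elim: s c => [|j s IH] c /=; rewrite ?addr0 // IH; ring. Qed.

(** A regular sequence of length [n] in the ideal generated by [x] kills the
    cohomology of [wedge x] in degrees below [n].  Contracting with the
    coefficients of [s_l = sum_j a_j x_j] shows that [s_l] kills cohomology: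
    [s_l c = wedge x b] for [b = sum_j a_j c (j :: _)].  Modulo
    [s_l], this [b] is a cocycle of smaller degree, hence [b = wedge x h + s_l h']
    by induction, and [s_l] can be cancelled in [s_l c = s_l * wedge x h']. *)
Lemma regular_wedge_exact (x : J -> A) (s : seq A) (i l : nat) c :
  regular_seq s ->
  {in s, forall z, exists a : J -> A, z = \sum_j a j * x j} ->
  (l + i < size s)%N ->
  (forall r, size r = i.+1 -> wedge x c r \in ideal_gen (mem (take l s))) ->
  exists h, forall r, size r = i ->
    c r - wedge x h r \in ideal_gen (mem (take l s)).
Proof.
move=> [reg _] gen; elim: i l c => [|i IH] l c lti cc.
all: have lts : (l < size s)%N by apply: leq_ltn_trans lti; rewrite leq_addr.
all: have [a sE] := gen _ (mem_nth 0 lts).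
all: have hQ := ideal_gen_ideal (mem (take l s)); set Q := ideal_gen _ in hQ cc *.
all: pose b r := \sum_j a j * c (j :: r).
all: have homotopy r : s`_l * c r - wedge x b r
       = \sum_j a j * wedge x c (j :: r)
       by rewrite sE /b wedge_lin mulr_suml -sumrB; apply: eq_bigr => j _ /=; ring.
all: have sc r : (forall j, wedge x c (j :: r) \in Q) ->
       s`_l * c r - wedge x b r \in Q
       by move=> cr; rewrite homotopy; apply: ideal_sum => // j _; apply: idealM.
  exists (fun=> 0) => -[|//] _ /=; rewrite subr0; apply: (reg l) => //.
  by have := sc [::] (fun j => cc [:: j] erefl); rewrite /= subr0.
have {}sc r : size r = i.+1 -> s`_l * c r - wedge x b r \in Q.
  by move=> sr; apply: sc => j; apply: cc; rewrite /= sr.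
pose Q' := ideal_gen (mem (take l.+1 s)).
have hQ' : ideal_closed Q' by apply: ideal_gen_ideal.
have [h hE] : exists h, forall r, size r = i -> b r - wedge x h r \in Q'.
  apply: IH => [|r sr]; first by rewrite addSnnS.
  have -> : wedge x b r = s`_l * c r - (s`_l * c r - wedge x b r) by ring.
  apply: idealB => //; last by apply: ideal_gen_take_sub; apply: sc.
  by rewrite mulrC; apply: idealM => //; apply: nth_ideal_gen.
have [r|h' h'E] := @choice _ _
    (fun r v => size r = i -> b r - wedge x h r - v * s`_l \in Q).
  have [sr|sr] := eqVneq (size r) i; last by exists 0 => /eqP; rewrite (negPf sr).
  by have [v] := ideal_gen_takeS lts (hE r sr); exists v.
exists h' => r sr; apply: (reg l) => //.
have -> : s`_l * (c r - wedge x h' r) = (s`_l * c r - wedge x b r)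
    + wedge x (fun r' => b r' - wedge x h r' - h' r' * s`_l) r.
  rewrite !wedgeB wedge_twice.
  rewrite (@eq_wedge _ (fun r' => h' r' * s`_l) (fun r' => s`_l * h' r')).
    by rewrite wedgeZ; ring.
  by move=> r' _; rewrite mulrC.
apply: idealD => //; first exact: sc.
by apply: wedge_ideal => // r'; rewrite sr => -[sr']; apply: h'E.
Qed.

Definition unit_vec (k : J) : J -> A := fun j => (j == k)%:R.

Definition wedge_units (l : seq J) c := foldr (fun k => wedge (unit_vec k)) c l.

Lemma wedge_units_lin l (I : finType) (a : I -> A) (c : I -> seq J -> A) s :
  wedge_units l (fun r => \sum_i a i * c i r) s = \sum_i a i * wedge_units l (c i) s.
Proof.
elim: l s => [|k l IH] s //=.
by rewrite (@eq_wedge _ _ (fun r => \sum_i a i * wedge_units l (c i) r)) ?wedge_lin.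
Qed.

Lemma eq_wedge_units l c1 c2 s :
  (forall r, (size l + size r)%N = size s -> c1 r = c2 r) ->
  wedge_units l c1 s = wedge_units l c2 s.
Proof.
elim: l s => [|k l IH] s e12 /=; first exact: e12.
by apply: eq_wedge => r sr; apply: IH => r' sr'; apply: e12; rewrite -sr -sr'.
Qed.

Lemma wedge_units_comm l y c s :
  wedge y (wedge_units l c) s = (-1) ^+ size l * wedge_units l (wedge y c) s.
Proof.
elim: l s => [|k l IH] s /=; first by rewrite mul1r.
rewrite wedge_anticomm.
rewrite (@eq_wedge _ _ (fun r => (-1) ^+ size l * wedge_units l (wedge y c) r)) //.
by rewrite wedgeZ exprS; ring.
Qed.

Lemma wedge_units_twice l k c s : k \in l ->
  wedge_units l (wedge (unit_vec k) c) s = 0.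
Proof.
elim: l s => [|k' l IH] s //; rewrite inE => /predU1P[->|kl] /=; last first.
  rewrite (@eq_wedge _ _ (fun r => 0 * c r)) ?wedgeZ ?mul0r // => r _.
  by rewrite IH // mul0r.
rewrite (@eq_wedge _ _
  (fun r => (-1) ^+ size l * wedge (unit_vec k') (wedge_units l c) r)).
  by rewrite wedgeZ wedge_twice mulr0.
by move=> r _; rewrite wedge_units_comm mulrA -exprMn mulrN1 opprK expr1n mul1r.
Qed.

Lemma wedge_unit0 k c s : k \notin s -> wedge (unit_vec k) c s = 0.
Proof.
elim: s c => [|j s IH] c //=; rewrite inE negb_or => /andP[kj ks].
by rewrite IH // /unit_vec eq_sym (negPf kj) mul0r subrr.
Qed.

Lemma wedge_units_eval l c v : uniq l -> v \notin l ->
  wedge_units l c (rcons l v) = c [:: v].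
Proof.
elim: l => [|k l IH] //= /andP[kl ul]; rewrite inE negb_or => /andP[vk vl].
rewrite wedge_unit0; first by rewrite /unit_vec eqxx mul1r subr0 IH.
by rewrite mem_rcons inE negb_or eq_sym vk.
Qed.

(** This detects cocycles that are not coboundaries: the factor [f (h l)] does not
    depend on [v]. *)
Lemma wedge_eval (B : comNzRingType) (f : {rmorphism A -> B}) x h l v :
  (forall k, k \in l -> f (x k) = 0) ->
  f (wedge x h (rcons l v)) = (-1) ^+ size l * f (h l) * f (x v).
Proof.
elim: l h => [|k l IH] h x0 /=; first by rewrite subr0 mul1r rmorphM mulrC.
rewrite rmorphB rmorphM /= (x0 k) ?mem_head // IH; last first.
  by move=> k' k'l; rewrite x0 // inE k'l orbT.
by rewrite exprS; ring.
Qed.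

End Wedge.

(** * Zariski's lemma *)

Section Zariski.

Definition generates (B L : comNzRingType) (f : B -> L) (a : seq L) : Prop :=
  forall S : L -> Prop, (forall b, S (f b)) -> (forall x, x \in a -> S x) ->
    (forall u v, S u -> S v -> S (u + v)) ->
    (forall u v, S u -> S v -> S (u * v)) -> forall z, S z.

Lemma integral_lead_mul (B L : comNzRingType) (f : {rmorphism B -> L})
    (q : {poly B}) (x : L) :
  q != 0 -> root (map_poly f q) x -> integralOver f (f (lead_coef q) * x).
Proof.
move=> q0 /rootP; set c := lead_coef q; set d := (size q).-1.
have sq : size q = d.+1 by rewrite /d prednK // lt0n size_poly_eq0.
rewrite (@horner_coef_wide _ d.+1); last by rewrite -sq size_poly.
under eq_bigr do rewrite coef_map.
rewrite big_ord_recr /= -[q`_d]/c => qx0.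
have [d0|d_gt0] := posnP d.
  move: qx0; rewrite d0 big_ord0 add0r mulr1 => ->.
  by rewrite mul0r; apply: integral0.
exists ('X^d + \poly_(i < d) (q`_i * c ^+ (d.-1 - i))).
  rewrite monicE lead_coefDl ?lead_coefXn //.
  by rewrite size_polyXn ltnS size_poly.
apply/rootP; rewrite rmorphD /= map_polyXn hornerD hornerXn.
rewrite (@horner_coef_wide _ d); last first.
  by apply: leq_trans (size_poly _ _) _; rewrite size_poly.
under eq_bigr => i _ do
  rewrite coef_map coef_poly ltn_ord /= rmorphM rmorphXn exprMn.
transitivity (f c ^+ d.-1 * (f c * x ^+ d + \sum_(i < d) f q`_i * x ^+ i)).
  rewrite mulrDr mulr_sumr exprMn; congr (_ + _).
    by rewrite -{1}(prednK d_gt0) exprS; ring.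
  apply: eq_bigr => i _; have le_i : (i <= d.-1)%N by rewrite -ltnS prednK.
  by rewrite -[in RHS](subnK le_i) exprD; ring.
by rewrite addrC in qx0; rewrite qx0 mulr0.
Qed.

(** In a polynomial ring over a domain, no nonzero [h] has a power divisible by
    every nonzero element: [1 + 'X * h] would divide a power of [h], hence
    ['X * h] would be nilpotent modulo it as well as congruent to [-1]. *)
Lemma poly_not_gdomain (B : idomainType) (h : {poly B}) : h != 0 ->
  ~ forall b : {poly B}, b != 0 -> exists N c, h ^+ N = b * c.
Proof.
move=> h0 div; set b : {poly B} := 1 + 'X * h.
have sb : (1 < size b)%N.
  have sXh : size ('X * h) = (size h).+1 by rewrite mulrC size_mulX.
  have h_gt0 : (0 < size h)%N by rewrite size_poly_gt0.
  by rewrite /b addrC size_polyDl sXh ?size_poly1.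
have b0 : b != 0 by rewrite -size_poly_gt0; apply: leq_trans sb.
have [N [c hN]] := div b b0.
have [e eE] : exists e, ('X * h) ^+ N = (-1) ^+ N + b * e.
  have -> : 'X * h = -1 + b * 1 by rewrite /b; ring.
  elim: N {hN} => [|N [e IH]]; first by exists 0; rewrite mulr0 addr0.
  by rewrite !exprS IH; exists (-1 * e + 1 * (-1) ^+ N + b * e); ring.
have : b * ((-1) ^+ N * ('X ^+ N * c - e)) = 1.
  have -> : b * ((-1) ^+ N * ('X ^+ N * c - e))
          = (-1) ^+ N * ('X ^+ N * (b * c) - b * e) by ring.
  by rewrite -hN -exprMn eE addrK -exprMn mulrN1 opprK expr1n.
move=> be1; have := size_mul_eq1 b ((-1) ^+ N * ('X ^+ N * c - e)).
by rewrite be1 size_poly1 eqxx (gtn_eqF sb).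
Qed.

(** If a field [L] is generated as a ring by a domain [B] and finitely many
    elements, then these are algebraic over [B] and a single element of [B] has a
    power divisible by each nonzero element of [B].  If a generator [x] is
    transcendental, [B] and [x] generate a polynomial ring, over which the other
    generators generate [L], against [poly_not_gdomain].  When all are algebraic,
    let [h] clear the leading coefficients of their equations: each [z] in [L]
    has an integral multiple [h ^+ N * z], and the case [z = b^-1] is the
    claim. *)
Lemma zariski_gdomain (n : nat) (B : idomainType) (L : comNzRingType)
    (f : {rmorphism B -> L}) (a : seq L) :
  size a = n -> injective f -> (forall z : L, z != 0 -> exists w, z * w = 1) ->
  generates f a ->
  (forall x, x \in a -> exists2 q : {poly B}, q != 0 & root (map_poly f q) x) /\
  (exists2 h : B, h != 0 & forall b, b != 0 -> exists N c, h ^+ N = b * c).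
Proof.
elim/ltn_ind: n B L f a => n IH B L f a sa injf invL gen.
have alg x : x \in a -> exists2 q : {poly B}, q != 0 & root (map_poly f q) x.
  move=> ax; apply: contrapT => tr.
  have comx : commr_rmorph f x by move=> y; apply: mulrC.
  pose F : {rmorphism {poly B} -> L} := horner_morph comx.
  have FC b : F b%:P = f b by rewrite /F /= horner_morphC.
  have FX : F 'X = x by rewrite /F /= horner_morphX.
  have injF : injective F.
    move=> p q epq; apply/eqP; rewrite -subr_eq0; apply: contrapT => /negP pq.
    apply: tr; exists (p - q) => //; apply/rootP.
    by rewrite -[LHS]/(F (p - q)) rmorphB epq subrr.
  have [||h h0 div] := (IH (size (rem x a)) _ _ _ F (rem x a) erefl injF invL _).2.
  - by rewrite size_rem // sa prednK // -sa; case: (a) ax.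
  - move=> S SF Sa SD SM; apply: gen => // [b|y ay]; first by rewrite -FC.
    have [->|yx] := eqVneq y x; first by rewrite -FX.
    by apply: Sa; move: ay; rewrite (perm_mem (perm_to_rem ax)) inE (negPf yx).
  exact: poly_not_gdomain h0 div.
split=> //.
have [h h0 int_h] : exists2 h : B, h != 0 & forall x, x \in a -> integralOver f (f h * x).
  elim: (a) alg => [|x r IHr] algr; first by exists 1; rewrite ?oner_eq0.
  have [|h h0 int_h] := IHr; first by move=> y yr; apply: algr; rewrite inE yr orbT.
  have [q q0 qx] := algr x (mem_head _ _).
  exists (lead_coef q * h); first by rewrite mulf_neq0 ?lead_coef_eq0.
  move=> y; rewrite inE rmorphM => /predU1P[->|yr].
    rewrite mulrAC; apply: integral_mul; [exact: integral_lead_mul | exact: integral_id].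
  by rewrite -mulrA; apply: integral_mul; [exact: integral_id | exact: int_h].
exists h => // b b0.
have int_L z : exists N, integralOver f (f h ^+ N * z).
  move: z; apply: gen.
  - by move=> c; exists 0%N; rewrite mul1r; apply: integral_id.
  - by move=> x ax; exists 1%N; apply: int_h.
  - move=> u v [N hu] [M hv]; exists (N + M)%N.
    have -> : f h ^+ (N + M) * (u + v) = f (h ^+ M) * (f h ^+ N * u)
        + f (h ^+ N) * (f h ^+ M * v) by rewrite exprD !rmorphXn; ring.
    by apply: integral_add; apply: integral_mul => //; apply: integral_id.
  move=> u v [N hu] [M hv]; exists (N + M)%N.
  by rewrite exprD mulrACA; apply: integral_mul.
have [|w bw] := invL (f b); first by rewrite raddf_eq0.
have [N [p monp /rootP pw]] := int_L w; set d := (size p).-1.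
have sp : size p = d.+1 by rewrite /d prednK // lt0n size_poly_eq0 monic_neq0.
exists (N * d)%N, (- \sum_(i < d) p`_i * h ^+ (N * i) * b ^+ (d.-1 - i)).
have clear i : (i <= d)%N ->
    f b ^+ d * ((map_poly f p)`_i * (f h ^+ N * w) ^+ i)
    = f (p`_i * h ^+ (N * i) * b ^+ (d - i)).
  move=> le_i; rewrite -(subnK le_i) coef_map !rmorphM !rmorphXn addnK exprD.
  have -> : f b ^+ (d - i) * f b ^+ i * (f p`_i * (f h ^+ N * w) ^+ i)
    = f p`_i * (f h ^+ N) ^+ i * (f b ^+ (d - i)) * (f b * w) ^+ i.
    by rewrite !exprMn; ring.
  by rewrite bw expr1n mulr1 exprM.
rewrite (@horner_coef_wide _ d.+1) in pw; last by rewrite -sp size_poly.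
apply: injf; move: pw => /(congr1 (fun z => f b ^+ d * z)).
rewrite mulr0 mulr_sumr big_ord_recr /= clear // subnn mulr1.
rewrite -[p`_d]/(lead_coef p) (monicP monp) mul1r addrC => /eqP.
rewrite addr_eq0 => /eqP ->; rewrite mulrN rmorphN mulr_sumr rmorph_sum /=.
congr (- _); apply: eq_bigr => i _; rewrite clear ?(ltnW (ltn_ord i)) //.
congr (f _); rewrite [RHS]mulrC -[RHS]mulrA -exprSr; congr (_ * b ^+ _).
have d_gt0 : (0 < d)%N by apply: leq_ltn_trans (ltn_ord i).
by rewrite -subSn ?prednK // -ltnS prednK.
Qed.

End Zariski.

(** * Algebraic dependence by counting *)

Section Counting.
Variables (K : fieldType) (n : nat).
Implicit Types (p q : {mpoly K[n]}).

Definition deg_le (d : nat) p : Prop := forall mm, mm \in msupp p -> (mdeg mm <= d)%N.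

Lemma deg_leM d d' p q : deg_le d p -> deg_le d' q -> deg_le (d + d') (p * q).
Proof.
move=> hp hq mm /msuppM_le /allpairsP[[m1 m2] /= [m1p m2q ->]].
by rewrite mdegD leq_add ?hp ?hq.
Qed.

Lemma deg_le1 : deg_le 0 1.
Proof. by move=> mm; rewrite msupp1 inE => /eqP->; rewrite mdeg0. Qed.

Lemma deg_leX d i p : deg_le d p -> deg_le (i * d) (p ^+ i).
Proof.
move=> hp; elim: i => [|i IH]; first exact: deg_le1.
by rewrite exprS mulSn; apply: deg_leM.
Qed.

Lemma deg_leW d d' p : (d <= d')%N -> deg_le d p -> deg_le d' p.
Proof. by move=> dd' hp mm /hp /leq_trans; apply. Qed.

Lemma deg_le_monomial d m k (t : nat -> {mpoly K[n]}) (u : exponents m k) :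
  (forall j, (j < k)%N -> deg_le d (t j)) -> deg_le (k * (m * d)) (monomial t u).
Proof.
elim: k t u => [|k IH] t u ht /=; first exact: deg_le1.
rewrite mulSn; apply: deg_leM.
  by apply: deg_leW (deg_leX (i := u.1) (ht 0%N isT)); rewrite leq_mul2r ltnW ?orbT.
by apply: IH => j ltj; apply: ht.
Qed.

(** The [m ^ k] monomials with exponents below [m] in [k] polynomials of
    bounded degree live in a space whose dimension is of order [m ^ n], so
    [k > n] forces a linear relation for [m] large; finitely many families
    can even share the relation. *)
Lemma algebraic_dependence (I : finType) (k : nat) (t : I -> nat -> {mpoly K[n]}) :
  (n < k)%N -> exists m (c : exponents m k -> K),
    (exists u, c u != 0) /\
    forall i, \sum_u (c u)%:MP * monomial (t i) u = 0.
Proof.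
move=> ltnk.
pose d := (\max_(i : I) \max_(j < k) \max_(mm <- msupp (t i j)) mdeg mm)%N.
have hd i j : (j < k)%N -> deg_le d (t i j).
  move=> ltj mm hm; apply: leq_trans (leq_bigmax i).
  apply: leq_trans (leq_bigmax (Ordinal ltj)) => /=.
  by rewrite (leq_bigmax_seq (F := fun mm : 'X_{1..n} => mdeg mm)).
pose m := (#|I| * (k * d).+1 ^ n).+1; pose D := (k * (m * d)).+1.
have leq_exp2r_weak a b : (a <= b -> a ^ n <= b ^ n)%N.
  by case: (n) => // n' leab; rewrite leq_exp2r.
pose X := exponents m k; pose Y := (I * {ffun 'I_n -> 'I_D})%type.
(* [m] is chosen so that [#|I| * (m * (k * d).+1) ^ n < m ^ n * m]. *)
have cardXY : (#|{: Y}| < #|X|)%N.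
  rewrite card_prod card_ffun !card_ord card_exponents.
  have leD : (D <= m * (k * d).+1)%N by rewrite mulnS /D mulnCA -add1n leq_add.
  apply: (@leq_ltn_trans (m ^ n * (#|I| * (k * d).+1 ^ n))).
    by rewrite mulnCA leq_mul2l -expnMn leq_exp2r_weak ?orbT.
  apply: (@leq_trans (m ^ n * m)); first by rewrite ltn_pmul2l // expn_gt0.
  by rewrite -expnSr leq_pexp2l.
pose M := \matrix_(r < #|X|, s < #|{: Y}|)
  (monomial (t (enum_val s).1) (enum_val r))@_[multinom (enum_val s).2 j : nat | j < n].
have : kermx M != 0.
  rewrite kermx_eq0 -row_leq_rank -ltnNge; exact: leq_ltn_trans (rank_leq_col M) cardXY.
case/rowV0Pn => v /sub_kermxP vM v0.
exists m, (fun u => v 0 (enum_rank u)); split.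
  have /rV0Pn[r vr] := v0.
  by exists (enum_val r); rewrite enum_valK.
move=> i; apply/mpolyP => mm; rewrite mcoeff0 raddf_sum /=.
have [/forallP small|] := boolP [forall j, mm j < D]%N; last first.
  case/forallPn => j; rewrite -leqNgt => big; apply: big1 => u _.
  rewrite mcoeffCM; apply/eqP; rewrite mulf_eq0; apply/orP; right.
  rewrite mcoeff_eq0; apply/negP.
  move=> /(deg_le_monomial (fun j => hd i j)); apply/negP; rewrite -ltnNge.
  by apply: leq_trans big _; rewrite mdegE (bigD1 j) //= leq_addr.
pose w := [ffun j => Ordinal (small j)].
have := congr1 (fun N : 'rV_ _ => N 0 (enum_rank ((i, w) : Y))) vM.
rewrite !mxE => vM0; rewrite -[RHS]vM0 (reindex (@enum_rank X)) /=; last first.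
  by apply: onW_bij; apply: enum_rank_bij.
apply: eq_bigr => u _; rewrite mcoeffCM !mxE !enum_rankK /=; congr (_ * _@__).
by apply/mnmP => j; rewrite mnmE ffunE.
Qed.

End Counting.

(** * Quotients and evaluations *)

Lemma quotient_map (A : comNzRingType) (I : idealr A) :
  exists p : {rmorphism A -> {ideal_quot I}},
    (forall z, exists a, p a = z) /\ (forall a, p a = 0 <-> a \in (I : pred A)).
Proof.
exists (\pi_({ideal_quot I}))%qT; split=> [z|a]; first by exists (repr z); exact: reprK.
by rewrite -[in X in _ <-> X](subr0 a) Quotient.idealrBE raddf0; split=> [->|/eqP].
Qed.

Lemma quotient_exists (A : comNzRingType) (M : {pred A}) : idealr_closed M ->
  exists (L : comNzRingType) (p : {rmorphism A -> L}),
    (forall z, exists a, p a = z) /\ (forall a, p a = 0 <-> a \in M).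
Proof.
move=> idM; pose I : idealr A := HB.pack (M : A -> bool) (isIdealr.Build A M idM).
by have [p [p1 p2]] := quotient_map I; exists {ideal_quot I}, p.
Qed.

Lemma factor_rmorphism (R A B : comNzRingType) (p : {rmorphism R -> A})
    (f : {rmorphism R -> B}) :
  (forall z, exists a, p a = z) -> (forall u, p u = 0 -> f u = 0) ->
  exists g : {rmorphism A -> B}, forall u, g (p u) = f u.
Proof.
move=> surj ker; have [s sK] := choice surj.
pose g a := f (s a).
have gE u : g (p u) = f u.
  by apply/eqP; rewrite -subr_eq0 -rmorphB; apply/eqP/ker; rewrite rmorphB sK subrr.
have gB : zmod_morphism g.
  by move=> a b; rewrite -[a]sK -[b]sK -rmorphB !gE rmorphB.
have gM : monoid_morphism g.
  split; first by rewrite -(rmorph1 p) gE rmorph1.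
  by move=> a b; rewrite -[a]sK -[b]sK -rmorphM !gE rmorphM.
pose G : {rmorphism A -> B} := HB.pack g (GRing.isZmodMorphism.Build A B g gB)
  (GRing.isMonoidMorphism.Build A B g gM).
by exists G.
Qed.

Definition ker_pred (A D : nzRingType) (f : A -> D) : {pred A} := fun u => f u == 0.

Lemma ker_predE (A D : nzRingType) (f : A -> D) u : (u \in ker_pred f) = (f u == 0).
Proof. by []. Qed.

Lemma ker_prime (A : comNzRingType) (D : idomainType) (f : {rmorphism A -> D}) :
  prime_ideal (ker_pred f).
Proof.
split; last by move=> u v; rewrite !ker_predE rmorphM mulf_eq0.
split; rewrite ?ker_predE ?rmorph0 ?rmorph1 ?oner_eq0 // => a u v; rewrite !ker_predE.
by move=> /eqP u0 /eqP v0; rewrite rmorphD rmorphM u0 v0 mulr0 addr0.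
Qed.

Section PolynomialRing.
Variables (K : fieldType) (T : finType).
Local Notation R := {mpoly K[#|T|]}.
Local Notation var := (vertex_var K).

Section Eval.
Variables (B : comNzRingType) (k : {rmorphism K -> B}) (a : T -> B).

Definition ev : R -> B := mmap k (fun i => a (enum_val i)).

HB.instance Definition _ := GRing.RMorphism.on ev.

Lemma evC c : ev c%:MP = k c. Proof. exact: mmapC. Qed.

Lemma ev_var x : ev (var x) = a x.
Proof. by rewrite /ev /vertex_var mmapX mmap1U enum_rankK. Qed.

End Eval.

Lemma mpoly_ring_ind (S : R -> Prop) :
  (forall c, S c%:MP) -> (forall x, S (var x)) ->
  (forall u v, S u -> S v -> S (u + v)) -> (forall u v, S u -> S v -> S (u * v)) ->
  forall u, S u.
Proof.
move=> SC Sx SD SM; elim/mpolyind => [|c m p _ _ Sp]; first by rewrite -mpolyC0.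
apply: SD => //; rewrite -mul_mpolyC; apply: (SM) => //; rewrite mpolyXE_id.
apply: (big_ind S _ SM) => [|i _]; first by have := SC 1; rewrite mpolyC1.
elim: (m i) => [|n IH]; first by have := SC 1; rewrite mpolyC1.
by rewrite exprS; apply: SM => //; have := Sx (enum_val i); rewrite /vertex_var enum_valK.
Qed.

Lemma eq_rmorph_var (B : comNzRingType) (f g : {rmorphism R -> B}) :
  (forall c, f c%:MP = g c%:MP) -> (forall x, f (var x) = g (var x)) -> f =1 g.
Proof.
move=> fgC fgx; apply: mpoly_ring_ind => // u v fu fv.
  by rewrite !rmorphD fu fv.
by rewrite !rmorphM fu fv.
Qed.

End PolynomialRing.

(** Locked, so that unification never compares substitutions by unfolding
    them. *)
HB.lock Definition sub (K : fieldType) (T : finType) (p : T -> K) (S : {set T}) :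
    {rmorphism {mpoly K[#|T|]} -> {mpoly K[#|T|]}} :=
  ev (@mpolyC #|T| K) (fun x => if x \in S then (p x)%:MP else vertex_var K x).

Section Substitution.
Variables (K : fieldType) (T : finType).
Local Notation R := {mpoly K[#|T|]}.
Local Notation var := (vertex_var K).
Implicit Types (p : T -> K) (S : {set T}).

Lemma subE p S : sub p S =1
  ev (@mpolyC #|T| K) (fun x => if x \in S then (p x)%:MP else var x).
Proof. by move=> u; rewrite sub.unlock. Qed.

Lemma subC p S c : sub p S c%:MP = c%:MP. Proof. by rewrite subE evC. Qed.

Lemma sub_var p S x : sub p S (var x) = if x \in S then (p x)%:MP else var x.
Proof. by rewrite subE ev_var. Qed.

Lemma sub_sub p (S S' : {set T}) u : S \subset S' -> sub p S' (sub p S u) = sub p S' u.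
Proof.
move=> SS'; apply: (eq_rmorph_var (f := sub p S' \o sub p S)) => [c|x] /=.
  by rewrite !subC.
rewrite !sub_var; case: ifP => xS; last by rewrite sub_var.
by rewrite subC (subsetP SS' x xS).
Qed.

Lemma sub_residue p (S : {set T}) u :
  exists a : T -> R, u - sub p S u = \sum_(x in S) a x * (var x - (p x)%:MP).
Proof.
move: u; apply: mpoly_ring_ind.
- by move=> c; exists (fun=> 0); rewrite subC subrr big1 // => x _; rewrite mul0r.
- move=> y; rewrite sub_var; case: ifP => yS; last first.
    by exists (fun=> 0); rewrite subrr big1 // => x _; rewrite mul0r.
  exists (fun x => (x == y)%:R); rewrite (bigD1 y) //= eqxx mul1r big1 ?addr0 //.
  by move=> x /andP[_ /negPf->]; rewrite mul0r.
- move=> u v [a aE] [b bE]; exists (fun x => a x + b x).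
  under eq_bigr do rewrite mulrDl; rewrite big_split /= -aE -bE rmorphD /=; ring.
move=> u v [a aE] [b bE]; exists (fun x => a x * v + b x * sub p S u).
have -> : u * v - sub p S (u * v)
    = v * (u - sub p S u) + sub p S u * (v - sub p S v) by rewrite rmorphM /=; ring.
rewrite aE bE !mulr_sumr -big_split /=; apply: eq_bigr => x _; ring.
Qed.

Lemma var_neq0 (x : T) : var x != 0.
Proof.
apply/eqP => /(congr1 (ev (idfun : {rmorphism K -> K}) (fun=> 1))).
by rewrite ev_var rmorph0 => /eqP; rewrite oner_eq0.
Qed.

Lemma var_subC_neq0 (x : T) c : var x - c%:MP != 0.
Proof.
apply/eqP => /(congr1 (ev (idfun : {rmorphism K -> K}) (fun=> c + 1))).
by rewrite rmorphB /= ev_var evC rmorph0 addrC addKr => /eqP; rewrite oner_eq0.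
Qed.

Section CoordinatePrimes.
Variables (B : comNzRingType) (q : {rmorphism R -> B}) (p : T -> K).
Hypothesis q_surj : forall z, exists u, q u = z.

(** The image of the ideal of the coordinate subspace through [p] with directions
    outside [S].  It is prime when this subspace lies in the closed subscheme
    defined by the quotient, which is what [coord_closed] expresses. *)
Definition coord_prime S : {pred B} := fun z => `[< exists2 u, q u = z & sub p S u = 0 >].

Definition coord_closed S : Prop := forall u, q u = 0 -> sub p S u = 0.

Lemma coord_primeE S u : coord_closed S -> (q u \in coord_prime S) = (sub p S u == 0).
Proof.
move=> kS; apply/asboolP/eqP => [[v quv v0]|u0]; last by exists u.
by apply/eqP; rewrite -[u](subrK v) rmorphD /= v0 kS ?addr0 // rmorphB quv subrr.
Qed.

Lemma coord_prime_prime S : coord_closed S -> prime_ideal (coord_prime S).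
Proof.
move=> kS; have [g gE] := factor_rmorphism q_surj kS.
suff -> : coord_prime S = ker_pred g by apply: ker_prime.
apply/funext => z; have [u <-] := q_surj z.
by rewrite -[LHS]/(q u \in coord_prime S) coord_primeE // -gE.
Qed.

Lemma coord_closedU S S' : S \subset S' -> coord_closed S -> coord_closed S'.
Proof. by move=> SS' kS u /kS u0; rewrite -(sub_sub _ _ SS') u0 rmorph0. Qed.

Lemma coord_chain_step S S' x k : coord_closed S -> S \subset S' ->
  x \in S' -> x \notin S -> prime_chain_to (coord_prime S) k ->
  prime_chain_to (coord_prime S') k.+1.
Proof.
move=> kS SS' xS' xS chS; have kS' := coord_closedU SS' kS.
apply: prime_chain_snoc chS _ _ _; first exact: coord_prime_prime.
  move=> z; have [u <-] := q_surj z.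
  rewrite (coord_primeE u kS) (coord_primeE u kS') => /eqP u0.
  by rewrite -(sub_sub _ _ SS') u0 rmorph0.
move=> /(_ (q (var x - (p x)%:MP))); rewrite (coord_primeE _ kS) (coord_primeE _ kS').
rewrite !rmorphB /= !sub_var !subC xS' (negPf xS) subrr eqxx => /(_ isT).
by apply/negP; apply: var_subC_neq0.
Qed.

Lemma coord_chain S (l : seq T) k : coord_closed S -> uniq l ->
  (forall x, x \in l -> x \notin S) -> prime_chain_to (coord_prime S) k ->
  prime_chain_to (coord_prime (S :|: [set x in l])) (k + size l).
Proof.
elim: l S k => [|x l IH] S k kS; first by rewrite addn0 set_nil setU0.
move=> /= /andP[xl ul] lS chS; rewrite set_cons setUA addnS -addSn [S :|: _]setUC.
apply: IH ul _ _.
- exact: coord_closedU (subsetUr [set x] S) kS.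
- move=> y yl; rewrite !inE negb_or (memPn xl y yl) /=.
  by apply: lS; rewrite inE yl orbT.
apply: (coord_chain_step kS (subsetUr [set x] S) (setU11 x S) _ chS).
by apply: lS; rewrite mem_head.
Qed.

End CoordinatePrimes.

End Substitution.

(** * The edge ideal *)

Section EdgeIdealTheory.
Variables (K : fieldType) (T : finType) (e : rel T).
Local Notation R := {mpoly K[#|T|]}.
Local Notation var := (vertex_var K).

Lemma independentP (F : {set T}) :
  reflect (forall x y, x \in F -> y \in F -> ~~ e x y) (independent e F).
Proof.
apply: (iffP forall_inP) => [h x y xF yF|h x xF]; last first.
  by apply/forall_inP => y; apply: h.
by move/forall_inP: (h x xF); apply.
Qed.

Lemma independent_sub (F H : {set T}) : F \subset H -> independent e H -> independent e F.
Proof.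
move=> /subsetP FH /independentP iH; apply/independentP => x y xF yF.
by apply: iH; apply: FH.
Qed.

Lemma edge_in_ideal x y : e x y -> var x * var y \in edge_ideal K e.
Proof.
move=> exy; apply: mem_ideal_gen; rewrite inE.
by apply/existsP; exists x; apply/existsP; exists y; rewrite exy eqxx.
Qed.

Lemma edge_ideal_killed (B : comNzRingType) (f : {rmorphism R -> B}) :
  (forall x y, e x y -> f (var x) * f (var y) = 0) ->
  forall u, u \in edge_ideal K e -> f u = 0.
Proof.
move=> fe u /asboolP[n [a [b [Sb ->]]]]; rewrite rmorph_sum big1 // => i _.
have /existsP[x /existsP[y /andP[exy /eqP->]]] := Sb i.
by rewrite /= !rmorphM /= fe // mulr0.
Qed.

(** This makes evaluations at points with independent support, possibly with
    coordinates in another ring, factor through the edge ring. *)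
Lemma ev_kills_edges (B : comNzRingType) (k : {rmorphism K -> B}) (a : T -> B)
    (H : {set T}) : independent e H -> (forall x, x \notin H -> a x = 0) ->
  forall u, u \in edge_ideal K e -> ev k a u = 0.
Proof.
move=> /independentP iH a0; apply: (edge_ideal_killed (f := ev k a)) => x y exy.
rewrite /= !ev_var.
have [xH|/a0->] := boolP (x \in H); last by rewrite mul0r.
have [yH|/a0->] := boolP (y \in H); last by rewrite mulr0.
by case/negP: (iH x y xH yH).
Qed.

Definition msupport (m : 'X_{1..#|T|}) : {set T} := [set x | m (enum_rank x) != 0%N].

Lemma sub0_monomial (H : {set T}) (m : 'X_{1..#|T|}) :
  sub (fun=> 0) (~: H) 'X_[m] = if msupport m \subset H then 'X_[m] else 0 :> R.
Proof.
rewrite mpolyXE_id rmorph_prod /=; case: ifP => [/subsetP mH|/negbT].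
  apply: eq_bigr => i _; rewrite rmorphXn /=.
  have := sub_var (fun=> 0 : K) (~: H) (enum_val i); rewrite /vertex_var enum_valK => ->.
  rewrite inE; case: ifP => // iH.
  have [->|mi] := eqVneq (m i) 0%N; first by rewrite !expr0.
  by case/negP: iH; apply: mH; rewrite inE enum_valK.
case/subsetPn => x; rewrite inE => mx xH; rewrite (bigD1 (enum_rank x)) //=.
by rewrite rmorphXn /= sub_var inE xH mpolyC0 expr0n (negPf mx) mul0r.
Qed.

(** The edge ideal is the intersection of the primes of the independent sets:
    any monomial of a polynomial in this intersection has a support that is not
    independent. *)
Lemma edge_ideal_inter (u : R) : irreflexive e ->
  (forall H, independent e H -> sub (fun=> 0) (~: H) u = 0) -> u \in edge_ideal K e.
Proof.
move=> e_irr u0; have hI := ideal_gen_ideal (@edge_monomials K T e).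
rewrite (mpolyE u) big_seq; apply: ideal_sum => // m mu.
rewrite -mul_mpolyC; apply: idealM => //.
have [indep|] := boolP (independent e (msupport m)).
  have uE H : sub (fun=> 0) (~: H) u
      = \sum_(m' <- msupp u) (u@_m')%:MP * (if msupport m' \subset H then 'X_[m'] else 0).
    rewrite [in LHS](mpolyE u) rmorph_sum; apply: eq_bigr => m' _.
    by rewrite -mul_mpolyC rmorphM subC sub0_monomial.
  move/(congr1 (mcoeff m)): (u0 _ indep).
  rewrite uE mcoeff0 (raddf_sum (mcoeff m)) (bigD1_seq m mu (msupp_uniq u)) /=.
  rewrite subxx mcoeffCM mcoeffX eqxx mulr1 big1 ?addr0 => [/eqP|m' m'm].
    by rewrite mcoeff_eq0 mu.
  rewrite mcoeffCM; case: ifP => _; last by rewrite mcoeff0 mulr0.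
  by rewrite mcoeffX (negPf m'm) mulr0.
move/forall_inPn => [x mx /forall_inPn[y my /negPn exy]].
rewrite inE in mx; rewrite inE in my.
have xy : x != y by apply: contraL exy => /eqP->; rewrite e_irr.
have le_m : (U_(enum_rank x) + U_(enum_rank y) <= m)%MM.
  apply/mnm_lepP => i; rewrite mnmDE !mnm1E.
  case: (enum_rank x =P i) => [<-|_].
    by rewrite (inj_eq enum_rank_inj) eq_sym (negPf xy) lt0n.
  by case: (enum_rank y =P i) => [<-|_] //; rewrite lt0n.
rewrite -(submK le_m) mpolyXD mpolyXD; apply: idealM => //.
exact: edge_in_ideal.
Qed.

Lemma edge_ideal_inter_max (u : R) : irreflexive e ->
  (forall H, maxset (independent e) H -> sub (fun=> 0) (~: H) u = 0) ->
  u \in edge_ideal K e.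
Proof.
move=> e_irr u0; apply: edge_ideal_inter => // F iF.
have [H mH FH] := maxset_exists iF.
by rewrite -(sub_sub _ u (S := ~: H)) ?setCS // u0 ?rmorph0.
Qed.

Lemma edge_ring_map : exists p : {rmorphism R -> edge_ring K e},
  (forall z, exists a, p a = z) /\ (forall u, p u = 0 <-> u \in edge_ideal K e).
Proof. exact: quotient_map. Qed.

End EdgeIdealTheory.

(** * Connectedness of links *)

Section Links.
Variables (K : fieldType) (T : finType) (e : rel T).
Hypotheses (e_sym : ssrbool.symmetric e) (e_irr : irreflexive e).
Local Notation R := {mpoly K[#|T|]}.
Local Notation var := (vertex_var K).

Lemma sub_setT (p : T -> K) (u : R) :
  sub p setT u = (ev (idfun : {rmorphism K -> K}) p u)%:MP.
Proof.
apply: (eq_rmorph_var (f := sub p setT)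
  (g := @mpolyC #|T| K \o ev (idfun : {rmorphism K -> K}) p)) => [c|x] /=.
  by rewrite subC evC.
by rewrite sub_var inE ev_var.
Qed.

Definition link_vertices (F : {set T}) : {set T} :=
  [set v | (v \notin F) && [forall f in F, ~~ e v f]].

Lemma link_vertex_independent (F : {set T}) v :
  independent e F -> v \in link_vertices F -> independent e (v |: F).
Proof.
move=> /independentP iF; rewrite inE => /andP[_ /forall_inP vF].
apply/independentP => x y; rewrite !inE => /predU1P[->|xF] /predU1P[->|yF].
- by rewrite e_irr.
- exact: vF.
- by rewrite e_sym; apply: vF.
exact: iF.
Qed.

(** Hartshorne's argument, made explicit.  Let [M] be the maximal ideal of the
    point that is 1 on [F] and 0 elsewhere; near it, the edge ring is that of the
    link of [F].  When the vertices of the link split as [W1] and [W2] without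
    faces across, the function that is 1 on the [W1]-part and 0 on the [W2]-part
    is not in the ring, but its products with the variables of the link are.  After
    multiplication by the product [z] of the variables in [F], they give a cocycle
    [e_F /\ sum_(v in W1) z v e_v], of degree [#|F|.+1].  It is not a
    coboundary: its primitive would take, at the common point of two affine lines
    in the directions of [W1] and of [W2], the value 1 by the first line and 0
    by the second.  So the depth is at most [#|F|.+1], whereas the height is at
    least the size of any face containing [F]. *)
Lemma CM_link_connected (F W1 W2 H : {set T}) (w1 w2 : T) :
  CM_graph K e -> independent e F -> W1 :|: W2 = link_vertices F ->
  w1 \in W1 -> w2 \in W2 -> (forall x y, x \in W1 -> y \in W2 -> e x y) ->
  independent e H -> F \subset H -> (#|H| <= #|F|.+1)%N.
Proof.
move=> CM iF W12 w1W w2W across iH FH.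
have link1 x : x \in W1 -> x \in link_vertices F by move=> xW; rewrite -W12 inE xW.
have link2 x : x \in W2 -> x \in link_vertices F by move=> xW; rewrite -W12 inE xW orbT.
have w2W1 : w2 \notin W1 by apply/negP => /across/(_ w2W); rewrite e_irr.
have [p [p_surj p_ker]] := edge_ring_map K e.
pose pt x : K := (x \in F)%:R.
have pt0 x : x \notin F -> pt x = 0 by rewrite /pt => /negPf->.
have lift (B : comNzRingType) (k : {rmorphism K -> B}) a (H' : {set T}) :
    independent e H' -> (forall x, x \notin H' -> a x = 0) ->
    exists g : {rmorphism edge_ring K e -> B}, forall u, g (p u) = ev k a u.
  move=> iH' a0; apply: (factor_rmorphism (f := ev k a)) => // u /p_ker.
  exact: (ev_kills_edges k iH' a0).
have [g0 g0E] := lift K idfun pt F iF pt0.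
pose M := ker_pred g0.
have g0C c : g0 (p c%:MP) = c by rewrite g0E evC.
have maxM : maximal_ideal M.
  split; first by case: (ker_prime g0).
  move=> J idJ MJ x Jx; have hJ := idealr_ideal_closed idJ.
  rewrite ker_predE; apply/eqP; apply: contrapT => /eqP gx.
  have Jc : p (g0 x)%:MP \in J.
    rewrite -[p _](subKr x); apply: idealB => //; apply: MJ.
    by rewrite ker_predE rmorphB g0C subrr.
  case: idJ => _ /negP[]; rewrite -(rmorph1 p) -mpolyC1 -(mulVf gx).
  by rewrite mpolyCM rmorphM; apply: idealM.
have [d [[_ htM] [[s [sd reg sM]] _]]] := CM M maxM.
have leHd : (#|H| <= d)%N.
  have closedH : coord_closed p pt (~: H).
    move=> u /p_ker; rewrite subE; apply: (ev_kills_edges _ iH) => y yH.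
    by rewrite inE yH pt0 ?mpolyC0 //; apply: contra yH; apply: (subsetP FH).
  have closedT : coord_closed p pt setT by apply: coord_closedU closedH.
  apply: htM.
  apply: (@prime_chain_to_eq _ (coord_prime p pt (~: H :|: [set y in enum H]))).
    move=> z; have [u <-] := p_surj z.
    have -> : ~: H :|: [set y in enum H] = setT.
      by apply/setP => y; rewrite !inE mem_enum orNb.
    by rewrite coord_primeE // sub_setT mpolyC_eq0 ker_predE g0E.
  rewrite cardE -[size _]add0n; apply: coord_chain => //; first exact: enum_uniq.
    by move=> y; rewrite mem_enum inE negbK.
  exact/prime_chain0/coord_prime_prime.
rewrite leqNgt; apply/negP => bigH.
pose x v := p (var v - (pt v)%:MP).
have gen : {in s, forall z, exists a : T -> edge_ring K e, z = \sum_j a j * x j}.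
  move=> z /sM; have [u <-] := p_surj z; rewrite ker_predE g0E => /eqP u0.
  have [a aE] := sub_residue pt setT u.
  exists (fun j => p (a j)); rewrite -[u]subr0 -[0](mpolyC0 #|T| K) -u0 -sub_setT aE.
  rewrite rmorph_sum; apply: eq_big => [j|j _]; first by rewrite inE.
  by rewrite rmorphM.
(* Invertible near the point, and zero times any vertex that is neither in [F] nor
   in its link. *)
pose zeta := \prod_(f in F) p (var f).
pose y v := if v \in W1 then zeta * p (var v) else 0.
pose c := wedge_units (enum F) (wedge y (fun=> 1)).
have xN v : v \notin F -> x v = p (var v).
  by move=> vF; rewrite /x pt0 // mpolyC0 subr0.
have edge0 v w : e v w -> p (var v) * p (var w) = 0.
  by move=> vw; rewrite -rmorphM; apply/p_ker/edge_in_ideal.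
have xy j k : j \notin F -> k \notin F -> x j * y k = x k * y j.
  have half j' k' : j' \notin F -> j' \notin W1 -> k' \in W1 ->
      p (var j') * (zeta * p (var k')) = 0.
    move=> j'F j'W k'W; have [j'l|] := boolP (j' \in link_vertices F).
      rewrite mulrCA edge0 ?mulr0 // e_sym across //.
      by move: j'l; rewrite -W12 inE (negPf j'W).
    rewrite inE j'F /= => /forall_inPn[f fF /negPn j'f].
    by rewrite /zeta (bigD1 f) //= -!mulrA mulrA edge0 ?mul0r.
  move=> jF kF; rewrite !xN // /y.
  case: ifP => kW; case: ifP => jW; rewrite ?mulr0 //.
  - by rewrite mulrCA [RHS]mulrCA [_ * p (var j)]mulrC.
  - by rewrite half // jW.
  by rewrite half // kW.
have yF f : f \in F -> y f = 0.
  by move=> fF; rewrite /y; case: ifP => // /link1; rewrite inE fF.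
have cocycle r : size r = #|F|.+2 -> wedge x c r = 0.
  move=> sr; rewrite wedge_units_comm.
  rewrite (@eq_wedge_units _ _ _ _ (fun q => \sum_k (if k \in F then x k else 0)
      * wedge (unit_vec _ k) (wedge y (fun=> 1)) q)) => [|q].
    rewrite wedge_units_lin big1 ?mulr0 // => k _; case: ifP => kF; last by rewrite mul0r.
    by rewrite wedge_units_twice ?mulr0 // mem_enum.
  rewrite -cardE sr -addn2 => /addnI; case: q => [|j [|k []]] // _.
  rewrite (@eq_wedge_l _ _ _ (fun i => (if i \in F then 0 else x i)
     + \sum_k (if k \in F then x k else 0) * unit_vec _ k i)) => [|i].
    rewrite wedgeD_l wedge_lin_l -[RHS]add0r; congr (_ + _) => /=.
    rewrite !subr0 !mulr1; case: ifP => jF; case: ifP => kF.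
    - by rewrite !mul0r subrr.
    - by rewrite (yF j) // mul0r mulr0 subrr.
    - by rewrite (yF k) // mulr0 mul0r subrr.
    by rewrite xy ?jF ?kF // subrr.
  rewrite (bigD1 i) //= big1 ?addr0 => [|k' ki].
    by rewrite /unit_vec eqxx mulr1; case: ifP; rewrite ?add0r ?addr0.
  by rewrite /unit_vec eq_sym (negPf ki) mulr0.
have [|r sr|h hE] := @regular_wedge_exact _ _ x s #|F|.+1 0 c reg gen.
- by rewrite add0n sd; apply: leq_trans leHd.
- by rewrite cocycle //; apply: ideal0; apply: ideal_gen_ideal.
pose eta := (-1) ^+ #|F| * h (enum F).
(* The restriction to the line through the point in the direction of [w]. *)
have line w : w \in link_vertices F -> exists G : {rmorphism edge_ring K e -> {poly K}},
    [/\ forall z, (G z).[0] = g0 z, G (p (var w)) = 'X, G zeta = 1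
      & G (y w) = G eta * 'X].
  move=> wL; have wF : w \notin F by move: wL; rewrite inE => /andP[].
  pose a x := if x \in F then 1 else if x == w then 'X else 0 : {poly K}.
  have [|G GE] := lift _ (@polyC K) a _ (link_vertex_independent iF wL).
    by move=> v; rewrite !inE negb_or /a => /andP[/negPf-> /negPf->].
  have Gw : G (p (var w)) = 'X by rewrite GE ev_var /a (negPf wF) eqxx.
  have GF f : f \in F -> G (p (var f)) = 1 by move=> fF; rewrite GE ev_var /a fF.
  exists G; split=> // [z||].
  - have [u <-] := p_surj z; rewrite GE g0E.
    apply: (eq_rmorph_var (f := horner_eval 0 \o ev (@polyC K) a)
                          (g := ev (idfun : {rmorphism K -> K}) pt)) => [b|v] /=.
      by rewrite !evC /horner_eval hornerC.
    rewrite !ev_var /horner_eval /a /pt; case: ifP => _; first by rewrite hornerC.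
    by case: ifP => _; rewrite ?hornerX ?horner0.
  - by rewrite /zeta rmorph_prod big1 // => f /GF.
  have := hE (rcons (enum F) w); rewrite size_rcons -cardE => /(_ erefl).
  rewrite take0 => /asboolP[[|n] [b [b' [Sb]]]]; last by have := Sb ord0.
  rewrite big_ord0 => /subr0_eq; rewrite /c wedge_units_eval ?enum_uniq ?mem_enum //=.
  rewrite subr0 mulr1 => ->; rewrite wedge_eval => [|f]; last first.
    by rewrite mem_enum => fF; rewrite /x !rmorphB /= GF // GE evC /pt fF subrr.
  by rewrite xN // Gw /eta rmorphM rmorphXn rmorphN1 -cardE.
have [G1 [ev1 X1 zeta1 y1]] := line w1 (link1 _ w1W).
have [G2 [ev2 X2 zeta2 y2]] := line w2 (link2 _ w2W).
have XI : GRing.rreg ('X : {poly K}) by apply: monic_rreg; apply: monicX.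
have eta1 : G1 eta = 1.
  by apply: XI; rewrite -y1 /y w1W rmorphM zeta1 X1.
have eta2 : G2 eta = 0.
  by apply: XI; rewrite -y2 /y (negPf w2W1) rmorph0 mul0r.
have := ev1 eta; rewrite -ev2 eta1 eta2 hornerC horner0 => /eqP.
by rewrite oner_eq0.
Qed.

End Links.

(** * Cohen-Macaulay graphs are unmixed *)

Section Covers.
Variables (T : finType) (e : rel T).

Lemma vertex_coverC (H : {set T}) : vertex_cover e (~: H) = independent e H.
Proof.
apply/forallP/independentP => [h x y xH yH|h x].
  by apply/negP => exy; have /forallP/(_ y) := h x; rewrite exy !inE xH yH.
apply/forallP => y; apply/implyP => exy; rewrite !inE -negb_and.
by apply/negP => /andP[xH yH]; case/negP: (h x y xH yH).
Qed.

Lemma minset_cover (C : {set T}) :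
  minset (vertex_cover e) C = maxset (independent e) (~: C).
Proof. by rewrite minmaxset; apply: maxset_eq => B /=; rewrite vertex_coverC. Qed.

Lemma unmixedP : unmixed e <->
  (forall H H', maxset (independent e) H -> maxset (independent e) H' -> #|H| = #|H'|).
Proof.
split=> [um H H' mH mH'|um C C'].
  apply/eqP; rewrite -(eqn_add2r #|~: H|) cardsC -(cardsC H') eqn_add2l; apply/eqP.
  by apply: um; rewrite minset_cover setCK.
rewrite !minset_cover => mC mC'; apply/eqP.
by rewrite -(eqn_add2r #|~: C|) cardsC -(cardsC C') eqn_add2l (um _ _ mC mC').
Qed.

End Covers.

(** Of two facets of different sizes, take a pair [H], [H'] with the largest
    intersection [F].  Facets through [F] of size [#|H|] share no vertex outside
    [F] with the facets of other sizes, so they disconnect the link of [F]. *)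
Lemma CM_unmixed (K : fieldType) (T : finType) (e : rel T) :
  ssrbool.symmetric e -> irreflexive e -> CM_graph K e -> unmixed e.
Proof.
move=> e_sym e_irr CM; apply/unmixedP => H0 H0' mH0 mH0'.
apply: contrapT => /eqP ne0; pose mx := maxset (independent e).
have ok0 : [&& mx (H0, H0').1, mx (H0, H0').2 & #|(H0, H0').1| != #|(H0, H0').2|].
  by apply/and3P.
case: (@arg_maxnP _ (H0, H0') (fun P => [&& mx P.1, mx P.2 & #|P.1| != #|P.2|])
  (fun P => #|P.1 :&: P.2|) ok0) => -[H H'] /= /and3P[mH mH' ne] maxP.
set F := H :&: H' in maxP.
have iH := maxsetp mH; have iH' := maxsetp mH'.
have meet (H1 H2 : {set T}) v : mx H1 -> mx H2 -> #|H1| != #|H2| ->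
    F \subset H1 -> F \subset H2 ->
    v \in H1 -> v \in H2 -> v \in F.
  move=> m1 m2 ne12 F1 F2 v1 v2; apply/negPn/negP => vF.
  have := maxP (H1, H2); rewrite /= m1 m2 ne12 => /(_ isT); apply/negP; rewrite -ltnNge.
  apply: proper_card; apply/properP; split; first by rewrite subsetI F1.
  by exists v => //; rewrite inE v1.
pose W1 := [set v in link_vertices e F |
  [exists H1 : {set T}, [&& mx H1, v |: F \subset H1 & #|H1| == #|H|]]].
pose W2 := link_vertices e F :\: W1.
have iF : independent e F by apply: independent_sub iH; apply: subsetIl.
have linkH (G : {set T}) v : F \subset G -> independent e G ->
    v \in G :\: F -> v \in link_vertices e F.
  move=> FG /independentP iG; rewrite inE => /andP[vF vG]; rewrite inE vF /=.
  by apply/forall_inP => w wF; apply: iG => //; apply: (subsetP FG).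
have FH : F \subset H by apply: subsetIl.
have FH' : F \subset H' by apply: subsetIr.
have new (G G' : {set T}) : mx G -> mx G' -> #|G| != #|G'| -> G :&: G' = F ->
    exists v, v \in G :\: F.
  move=> mG mG' neG GG'; apply/set0Pn; apply: contra neG; rewrite setD_eq0 -GG' => GF.
  have GG : G \subset G' by apply: subset_trans GF (subsetIr _ _).
  by rewrite (maxsetsup mG (maxsetp mG') GG).
have [w1 w1H] := new H H' mH mH' ne erefl.
have [|w2 w2H] := new H' H mH' mH _ (setIC _ _); first by rewrite eq_sym.
have w1W : w1 \in W1.
  rewrite inE (linkH H) //=; apply/existsP; exists H.
  by rewrite mH eqxx subUset sub1set FH; move: w1H; rewrite inE => /andP[_ ->].
have w2W : w2 \in W2.
  rewrite inE (linkH H') // andbT inE negb_and; apply/orP; right.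
  apply/existsP => -[H1 /and3P[m1 /subUsetP[w21 F1] /eqP c1]].
  move: w2H; rewrite inE => /andP[/negP w2F w2H']; apply: w2F.
  by apply: (meet H1 H') => //; rewrite ?c1 // -sub1set.
have across x y : x \in W1 -> y \in W2 -> e x y.
  rewrite inE => /andP[xL /existsP[H1 /and3P[m1 /subUsetP[x1 F1] c1]]].
  rewrite inE => /andP[yW1 yL]; apply/negPn/negP => nexy.
  have iG : independent e (x |: (y |: F)).
    have /independentP iyF := link_vertex_independent e_sym e_irr iF yL.
    have /independentP ixF := link_vertex_independent e_sym e_irr iF xL.
    apply/independentP => u v /setU1P[->|uG] /setU1P[->|vG].
    - by rewrite e_irr.
    - case/setU1P: vG => [->|vF] //.
      by apply: ixF; [apply: setU11 | apply: setU1r].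
    - rewrite e_sym; case/setU1P: uG => [->|uF] //.
      by apply: ixF; [apply: setU11 | apply: setU1r].
    exact: iyF.
  have [G mG /subUsetP[xG yFG]] := maxset_exists iG.
  have /subUsetP[_ FG] := yFG; rewrite sub1set in xG.
  have [cG|cG] := eqVneq #|G| #|H|.
    case/negP: yW1; rewrite inE yL; apply/existsP; exists G.
    by rewrite /mx mG yFG cG eqxx.
  have /negP[] : x \notin F by move: xL; rewrite inE => /andP[].
  by apply: (meet H1 G) => //; rewrite ?(eqP c1) 1?eq_sym // -sub1set.
have W12 : W1 :|: W2 = link_vertices e F.
  apply/setP => v; rewrite in_setU in_setD; case: (boolP (v \in W1)) => //=.
  by rewrite inE => /andP[->].
have bound := CM_link_connected e_sym e_irr CM iF W12 w1W w2W across.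
have big (G : {set T}) v : F \subset G -> v \in G :\: F -> (#|F| < #|G|)%N.
  move=> FG; rewrite inE => /andP[vF vG].
  by apply: proper_card; apply/properP; split=> //; exists v.
case/negP: ne; rewrite eqn_leq.
rewrite (leq_trans (bound H iH FH)) ?(leq_trans (bound H' iH' FH')) //.
- exact: big w1H.
exact: big w2H.
Qed.

(** * Unmixed bipartite graphs *)

Section Hall.
Variables (T : finType) (e : rel T).

Definition neighbours (B S : {set T}) := [set b in B | [exists a in S, e a b]].

Lemma neighboursP (B S : {set T}) b :
  reflect (b \in B /\ exists2 a, a \in S & e a b) (b \in neighbours B S).
Proof. by rewrite inE; apply: (iffP andP) => -[bB /exists_inP]. Qed.

(** Hall's marriage theorem, by induction on [A]: either some proper nonempty
    subset has exactly as many neighbours as elements, and it can be matched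
    separately from its complement; or there is slack, and any edge can be matched
    first. *)
Lemma hall (A B : {set T}) :
  (forall S : {set T}, S \subset A -> #|S| <= #|neighbours B S|)%N ->
  exists f : T -> T, {in A &, injective f} /\
    forall a, a \in A -> f a \in B /\ e a (f a).
Proof.
have [n leAn] := ubnP #|A|; elim: n A B leAn => // n IH A B; rewrite ltnS => leAn hallA.
have [->|/set0Pn[a aA]] := eqVneq A set0.
  by exists id; split=> a; rewrite inE.
have [/existsP[S /and4P[SA S0 /eqP SE ltS]]|noS] := boolP [exists S : {set T},
    [&& S \subset A, S != set0, #|S| == #|neighbours B S| & (#|S| < #|A|)%N]].
  have [||f1 [inj1 f1P]] := IH S (neighbours B S).
  - exact: leq_trans ltS leAn.
  - move=> S' S'S; apply: leq_trans (hallA S' (subset_trans S'S SA)) _.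
    apply/subset_leq_card/subsetP => b /neighboursP[bB [a' a'S' ea'b]].
    apply/neighboursP; split; last by exists a'.
    by apply/neighboursP; split=> //; exists a' => //; apply: (subsetP S'S).
  have [||f2 [inj2 f2P]] := IH (A :\: S) (B :\: neighbours B S).
  - apply: leq_trans leAn; rewrite cardsD (setIidPr SA) ltn_subrL.
    by rewrite !card_gt0 S0; apply/set0Pn; exists a.
  - move=> S'; rewrite subsetD => /andP[S'A disj].
    have := hallA (S :|: S'); rewrite subUset SA S'A => /(_ isT).
    rewrite cardsU disjoint_setI0 1?disjoint_sym // cards0 subn0 => le1.
    rewrite -(leq_add2l #|S|); apply: leq_trans le1 _; rewrite SE -cardsUI -[leqLHS]addn0.
    apply: leq_add => //; apply/subset_leq_card/subsetP => b.
    move=> /neighboursP[bB [a' a'S ea'b]]; rewrite inE.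
    have [//|bN] := boolP (b \in neighbours B S) => /=.
    apply/neighboursP; split; first by rewrite inE bN.
    exists a' => //; case/setUP: a'S => // a'S.
    by case/negP: bN; apply/neighboursP; split=> //; exists a'.
  have cross x y : x \in S -> y \in A :\: S -> f1 x != f2 y.
    move=> xS yS; apply: contraTneq (f1P x xS).1 => ->.
    by have := (f2P y yS).1; rewrite inE => /andP[].
  exists (fun x => if x \in S then f1 x else f2 x); split.
    move=> x y xA yA /=; case: ifP => xS; case: ifP => yS; first exact: inj1.
    - by move=> E; have := cross x y xS; rewrite inE yS yA E eqxx => /(_ isT).
    - by move=> E; have := cross y x yS; rewrite inE xS xA E eqxx => /(_ isT).
    by apply: inj2; rewrite inE ?xS ?yS.
  move=> x xA; case: ifP => xS; last by have [] := f2P x; rewrite inE ?xS // => /andP[].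
  by have [/neighboursP[]] := f1P x xS.
have [b /neighboursP[bB [a' /set1P-> eab]]] : exists b, b \in neighbours B [set a].
  apply/set0Pn; rewrite -card_gt0 -(cards1 a); apply: hallA.
  by rewrite sub1set.
have [||f [injf fP]] := IH (A :\ a) (B :\ b).
- by apply: leq_trans leAn; rewrite (cardsD1 a A) aA.
- move=> S SAa; have [->|S0] := eqVneq S set0; first by rewrite cards0.
  have SA : S \subset A by apply: subset_trans SAa (subD1set _ _).
  have ltS : (#|S| < #|A|)%N.
    by apply: leq_ltn_trans (subset_leq_card SAa) _; rewrite (cardsD1 a A) aA.
  have ltN : (#|S| < #|neighbours B S|)%N.
    rewrite ltn_neqAle hallA // andbT; apply: contra noS => cS.
    by apply/existsP; exists S; rewrite SA S0 cS ltS.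
  rewrite -ltnS; apply: leq_trans ltN _; rewrite (cardsD1 b) -add1n.
  apply: leq_add; first by case: (_ \in _).
  apply/subset_leq_card/subsetP => c; rewrite !inE => /and3P[cb cB ec].
  by rewrite cb cB.
exists (fun x => if x == a then b else f x); split.
  move=> x y xA yA /=; case: eqVneq => [->|xa]; case: eqVneq => [-> //|ya] E.
  - by have [] := fP y; rewrite ?inE ?ya // -E eqxx.
  - by have [] := fP x; rewrite ?inE ?xa // E eqxx.
  by apply: injf E; rewrite !inE ?xa ?ya.
move=> x xA; case: eqVneq => [->|xa] //.
by have [|] := fP x; rewrite !inE ?xa // => /andP[].
Qed.

End Hall.

Section UnmixedBipartite.
Variables (T : finType) (e : rel T) (A : {set T}).
Hypotheses (e_sym : ssrbool.symmetric e) (e_irr : irreflexive e).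
Hypothesis (e_bip : forall x y, e x y -> (x \in A) != (y \in A)).
Hypothesis (e_iso : no_isolated e).
Hypothesis (e_unmixed : unmixed e).
Local Notation facet := (maxset (independent e)).
Implicit Types (H S : {set T}) (a b c : T).

Lemma side_nonadjacent x y : (x \in A) = (y \in A) -> e x y = false.
Proof. by move=> xyA; apply/negP => /e_bip; rewrite xyA eqxx. Qed.

Lemma side_facet (S : {set T}) :
  (forall x y, e x y -> (x \in S) != (y \in S)) -> facet S.
Proof.
move=> bipS; apply/maxsetP; split.
  apply/independentP => x y xS yS; apply/negP => /bipS.
  by rewrite xS yS.
move=> B /independentP iB SB; apply/eqP; rewrite eqEsubset SB andbT.
apply/subsetP => x xB; apply/negPn/negP => xS; have [y exy] := e_iso x.
have yS : y \in S by have := bipS _ _ exy; rewrite (negPf xS); case: (y \in S).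
by case/negP: (iB x y xB (subsetP SB y yS)).
Qed.

Lemma facet_A : facet A. Proof. exact: side_facet. Qed.

Lemma facet_Ac : facet (~: A).
Proof.
by apply: side_facet => x y /e_bip; rewrite !inE; case: (x \in A); case: (y \in A).
Qed.

Lemma facet_card H : facet H -> #|H| = #|A|.
Proof. by move=> fH; have /unmixedP := e_unmixed; apply=> //; apply: facet_A. Qed.

Lemma card_Ac : #|~: A| = #|A|. Proof. exact: facet_card facet_Ac. Qed.

Lemma independent_card H : independent e H -> (#|H| <= #|A|)%N.
Proof.
by move=> /maxset_exists[H' fH' HH']; rewrite -(facet_card fH') subset_leq_card.
Qed.

Lemma facet_of_card H : independent e H -> #|H| = #|A| -> facet H.
Proof.
move=> /maxset_exists[H' fH' HH'] cH.
suff -> : H = H' by [].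
by apply/eqP; rewrite eqEcard HH' cH (facet_card fH') leqnn.
Qed.

(** Hall's condition holds, as a set [S] in [A] together with the non-neighbours
    of [S] in the complement of [A] is independent. *)
Lemma perfect_matching : exists f : T -> T, {in A &, injective f} /\
  forall a, a \in A -> f a \in ~: A /\ e a (f a).
Proof.
apply: hall => S SA; set N := neighbours _ _ _.
have NA : N \subset ~: A by apply/subsetP => b /neighboursP[].
have iSN : independent e (S :|: (~: A :\: N)).
  have half x y : x \in S -> y \in ~: A :\: N -> ~~ e x y.
    move=> xS /setDP[yA yN]; apply: contra yN => exy.
    by apply/neighboursP; split=> //; exists x.
  apply/independentP => x y /setUP[xS|xN] /setUP[yS|yN].
  - by rewrite side_nonadjacent // !(subsetP SA).
  - exact: half.
  - by rewrite e_sym half.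
  have := setDP xN => -[]; have := setDP yN => -[]; rewrite !inE => yA _ xA _.
  by rewrite side_nonadjacent // (negPf xA) (negPf yA).
have disj : S :&: (~: A :\: N) = set0.
  apply/setP => x; rewrite !inE; case: (boolP (x \in S)) => //= /(subsetP SA) ->.
  by rewrite andbF.
have := independent_card iSN; rewrite cardsU disj cards0 subn0 -card_Ac.
by rewrite -(cardsID N (~: A)) (setIidPr NA) leq_add2r.
Qed.

Section Matching.
Variable f : T -> T.
Hypothesis (f_inj : {in A &, injective f}).
Hypothesis (fP : forall a, a \in A -> f a \in ~: A /\ e a (f a)).

Lemma match_notin a : a \in A -> (f a \in A) = false.
Proof. by move/fP => [+ _]; rewrite inE => /negPf. Qed.

Lemma match_edge a : a \in A -> e a (f a). Proof. by move/fP=> []. Qed.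

Lemma match_image : f @: A = ~: A.
Proof.
apply/eqP; rewrite eqEcard card_in_imset // card_Ac leqnn andbT.
by apply/subsetP => _ /imsetP[a aA ->]; have [] := fP aA.
Qed.

Lemma match_surj x : x \notin A -> exists2 a, a \in A & x = f a.
Proof. by move=> xA; apply/imsetP; rewrite match_image inE. Qed.

(** A facet has as many vertices as there are pairs [a], [f a], and contains at
    most one of each pair. *)
Lemma facet_match H a : facet H -> a \in A -> (f a \in H) = (a \notin H).
Proof.
move=> fH aA; have /independentP iH := maxsetp fH.
have both b : b \in A -> ~~ ((b \in H) && (f b \in H)).
  move=> bA; apply/negP => /andP[bH fbH].
  by move: (iH _ _ bH fbH); rewrite match_edge.
have [aH|aH] /= := boolP (a \in H); first by have := both a aA; rewrite aH => /negPf.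
apply/negPn/negP => faH; have := facet_card fH; apply/eqP; rewrite neq_ltn.
apply/orP; left.
(* [g] sends [f b] back to [b]; it maps [H] injectively into [A] without [a]. *)
pose g x := if x \in A then x else odflt x [pick b in A | f b == x].
have gf b : b \in A -> g (f b) = b.
  move=> bA; rewrite /g match_notin //; case: pickP => [c /andP[cA /eqP]|/(_ b)] /=.
    exact: f_inj.
  by rewrite bA eqxx.
have injg : {in H &, injective g}.
  have gA x : x \in A -> g x = x by rewrite /g => ->.
  move=> x y xH yH; have [xA|/match_surj[b bA xE]] := boolP (x \in A);
    have [yA|/match_surj[c cA yE]] := boolP (y \in A).
  - by rewrite !gA.
  - rewrite (gA x) // yE gf // => xc; have := both c cA.
    by rewrite -{1}xc xH -yE yH.
  - rewrite (gA y) // xE gf // => xc; have := both b bA.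
    by rewrite {1}xc yH -xE xH.
  by rewrite xE yE !gf // => ->.
rewrite -(card_in_imset injg) [X in (_ < X)%N](cardsD1 a) aA add1n ltnS.
apply/subset_leq_card/subsetP => _ /imsetP[x xH ->]; rewrite !inE.
have [xA|/match_surj[b bA xE]] := boolP (x \in A).
  by rewrite /g xA xA andbT; apply: contraNneq aH => <-.
rewrite xE gf // bA andbT; apply: contraNneq faH => <-; by rewrite -xE.
Qed.

(** The order of Herzog and Hibi: [a] is below [b] when [a] is adjacent to the
    partner of [b].  Unmixedness makes it transitive. *)
Lemma match_trans a b c : a \in A -> b \in A -> c \in A ->
  e a (f b) -> e b (f c) -> e a (f c).
Proof.
move=> aA bA cA eab ebc; apply/negPn/negP => eac.
have iac : independent e [set a; f c].
  apply/independentP => x y /set2P[->|->] /set2P[->|->]; rewrite ?e_irr //.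
  by rewrite e_sym.
have [H fH /subUsetP[]] := maxset_exists iac; rewrite !sub1set => aH fcH.
have /independentP iH := maxsetp fH.
have := facet_match fH bA; have [bH|bH] /= := boolP (b \in H).
  by have := iH _ _ bH fcH; rewrite ebc.
by move=> fbH; have := iH _ _ aH fbH; rewrite eab.
Qed.

Lemma facet_upset H a b : facet H -> a \in A -> b \in A -> e a (f b) ->
  a \in H -> b \in H.
Proof.
move=> fH aA bA eab aH; have /independentP iH := maxsetp fH.
apply: contraTT eab => bH; apply: iH => //.
by rewrite facet_match.
Qed.

Lemma facet_determined H S : facet H -> facet S -> H :&: A = S :&: A -> H = S.
Proof.
move=> fH fS /setP HS; apply/setP => x.
have HSA a : a \in A -> (a \in H) = (a \in S).
  by move=> aA; have := HS a; rewrite !inE aA !andbT.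
have [|/match_surj[a aA ->]] := boolP (x \in A); first exact: HSA.
by rewrite !facet_match // HSA.
Qed.

(** Shelling: list the facets [H] by increasing [#|H :&: A|].  If [H'] comes
    after [H], then [H' :&: A] is not contained in [H :&: A]; take a minimal
    element [v] of [H' :&: A] that is not in [H].  Exchanging [v] for its partner
    gives a facet with a smaller intersection with [A], hence an earlier one. *)
Lemma facets_shelling :
  (forall a b, a \in A -> b \in A -> e a (f b) -> e b (f a) -> a = b) ->
  exists s : seq {set T}, [/\ uniq s, (forall H, (H \in s) = facet H) &
    forall i j, (i < j)%N -> (j < size s)%N ->
      exists2 v, v \in nth set0 s j :\: nth set0 s i &
      exists2 l, (l < j)%N & nth set0 s j :\: nth set0 s l = [set v]].
Proof.
move=> anti; pose key (H : {set T}) := #|H :&: A|.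
pose leK := relpre key leq; pose s := sort leK (enum [set H | facet H]).
have us : uniq s by rewrite sort_uniq enum_uniq.
have ms H : (H \in s) = facet H by rewrite mem_sort mem_enum inE.
have ss : sorted leK s by apply: sort_sorted => x y; apply: leq_total.
have mono i j : (i <= j)%N -> (j < size s)%N ->
    (key (nth set0 s i) <= key (nth set0 s j))%N.
  move=> ij js; apply: (@sorted_leq_nth _ leK _ _ set0 s ss); rewrite ?inE //.
  - by move=> x y z; apply: leq_trans.
  - by move=> x; apply: leqnn.
  exact: leq_ltn_trans ij js.
exists s; split=> // i j ij js; have is_ := ltn_trans ij js.
set H := nth set0 s i; set H' := nth set0 s j.
have fH : facet H by rewrite -ms mem_nth.
have fH' : facet H' by rewrite -ms mem_nth.
pose D := (H' :\: H) :&: A.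
have [t tD] : exists t, t \in D.
  apply/set0Pn; apply: contraTneq (ij) => D0.
  have sub : H' :&: A \subset H :&: A.
    apply/subsetP => x /setIP[xH' xA]; rewrite inE xA andbT; apply/negPn/negP => xH.
    by have := in_set0 x; rewrite -D0 !inE xH xH' xA.
  have HH' : H' :&: A = H :&: A.
    by apply/eqP; rewrite eqEcard sub; apply: mono (ltnW ij) js.
  have /eqP := facet_determined fH' fH HH'.
  by rewrite /H /H' nth_uniq // => /eqP ->; rewrite ltnn.
(* Minimality in this order, by counting the elements below. *)
pose down v := #|[set a in A | e a (f v)]|.
case: (@arg_minnP _ t (fun v => v \in D) down tD) => v vD minv.
have /setIP[/setDP[vH' vH] vA] := vD.
have low u : u \in A -> u \in H' -> e u (f v) -> u = v.
  move=> uA uH' euv; apply/eqP/negPn/negP => uv.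
  have uH : u \notin H by apply: contra vH; apply: facet_upset.
  have := minv u; rewrite !inE uH uH' uA => /(_ isT); apply/negP; rewrite -ltnNge.
  apply: proper_card; apply/properP; split.
    apply/subsetP => a; rewrite !inE => /andP[aA eau]; rewrite aA.
    exact: match_trans euv.
  exists v; rewrite !inE vA ?match_edge //=.
  by apply: contra uv => evu; rewrite (anti u v).
have /independentP iH' := maxsetp fH'.
have fvH' : f v \notin H' by rewrite facet_match // vH'.
pose G := f v |: (H' :\ v).
have iG : independent e G.
  have half x : x \in H' :\ v -> ~~ e x (f v).
    case/setD1P => xv xH'; have [xA|xA] := boolP (x \in A); last first.
      by rewrite side_nonadjacent // match_notin // (negPf xA).
    by apply: contra xv => exv; apply/eqP; apply: low.
  apply/independentP => x y /setU1P[->|xH'] /setU1P[->|yH'].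
  - by rewrite e_irr.
  - by rewrite e_sym half.
  - exact: half.
  by case/setD1P: xH' => _ xH'; case/setD1P: yH' => _; apply: iH'.
have fG : facet G.
  apply: facet_of_card => //; rewrite -(facet_card fH') cardsU1 (cardsD1 v H') vH'.
  by rewrite !inE (negPf fvH') andbF.
have keyG : (key G < key H')%N.
  apply: proper_card; apply/properP; split.
    apply/subsetP => x; rewrite !inE => /andP[xG xA]; rewrite xA andbT.
    by case/predU1P: xG xA => [->|/andP[] //]; rewrite match_notin.
  exists v; rewrite !inE ?vH' ?vA // eqxx andbT orbF.
  by apply: contraTneq (vA) => ->; rewrite match_notin.
exists v; first by rewrite inE vH vH'.
have sG : (index G s < size s)%N by rewrite index_mem ms.
exists (index G s); rewrite ?nth_index ?ms //.
  rewrite ltnNge; apply: contraL keyG => /mono/(_ sG).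
  by rewrite nth_index ?ms // -leqNgt.
apply/setP => x; rewrite !inE negb_or negb_and negbK.
have vfv : v != f v by apply: contraNneq fvH' => <-.
have [->|xv] := eqVneq x v; first by rewrite vH' vfv.
by rewrite /=; case: (x \in H'); rewrite ?andbF.
Qed.

End Matching.

(** In the unmixed case, the skeleton generated by the independent sets of the
    common size is the whole independence complex. *)
Lemma facets_skeleton :
  facets (pure_skeleton (indep_complex e) #|A|) = [set H | facet H].
Proof.
suff -> : pure_skeleton (indep_complex e) #|A| = [set F | independent e F].
  by apply/setP => H; rewrite !inE; apply: maxset_eq => F; rewrite inE.
apply/setP => F; rewrite !inE; apply/exists_inP/idP.
  by move=> [H]; rewrite inE => iH /andP[_ /independent_sub]; apply.
move=> /maxset_exists[H fH FH]; exists H; first by rewrite inE (maxsetp fH).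
by rewrite (facet_card fH) eqxx.
Qed.

End UnmixedBipartite.

(** * Bounds on height and depth *)

Section DimensionBound.
Variables (K : fieldType) (A : comNzRingType) (f : {rmorphism K -> A}).

Definition dim_le (n : nat) : Prop := forall t : nat -> A,
  exists m (c : exponents m n.+1 -> K),
    (exists u, c u != 0) /\ \sum_u f (c u) * monomial t u = 0.

Lemma dim_le_chain n k (Q : nat -> {pred A}) (t : nat -> A) : dim_le n ->
  (forall i, (i <= k)%N -> idealr_closed (Q i)) ->
  (forall i, (i < k)%N -> [/\ {subset Q i <= Q i.+1}, t i \in Q i.+1 &
                              forall u, t i * u \in Q i -> u \in Q i]) ->
  (k <= n)%N.
Proof.
move=> dimA idQ stepQ; rewrite leqNgt; apply/negP => ltnk.
have [m [c [c0 rel]]] := dimA t.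
have := @chain_independent K A f m n.+1 Q t c _ _ c0; rewrite rel.
have [Q0 _ _] := idQ 0%N (leq0n _); rewrite Q0.
case/(_ _ _)/negP => //.
- by move=> i /leq_trans le; apply: idQ; apply: le.
- by move=> i /leq_trans le; apply: stepQ; apply: le.
Qed.

Lemma prime_chain_le n k (P : {pred A}) : dim_le n -> prime_chain_to P k -> (k <= n)%N.
Proof.
move=> dimA [c [c1 c2 _]].
have [i|t tP] := @choice _ _ (fun i x => (i < k)%N -> x \in c i.+1 /\ x \notin c i).
  have [lti|] := ltnP i k; last by exists 0.
  have [_ nsub] := c2 i lti; apply: contrapT => no; apply: nsub => x xc.
  by apply: contrapT => xn; apply: no; exists x => _; split=> //; apply/negP.
apply: (dim_le_chain dimA (Q := c) (t := t)) => [i /c1[]//|i lti].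
have [t1 t2] := tP i lti; split=> // [|u]; first by case: (c2 i lti).
by move=> tu; apply: prime_idealP tu t2; apply: c1; apply: ltnW.
Qed.

Lemma regular_seq_le n (s : seq A) : dim_le n -> regular_seq s -> (size s <= n)%N.
Proof.
move=> dimA [reg prop].
apply: (dim_le_chain dimA (Q := fun i => ideal_gen (mem (take i s))) (t := nth 0 s)).
  move=> i _; apply: ideal_gen_closed; apply: contra prop.
  apply: ideal_gen_min; first exact: ideal_gen_ideal.
  by move=> x /= /mem_take xs; apply: mem_ideal_gen.
move=> i lti; split; [exact: ideal_gen_take_sub | exact: nth_ideal_gen |].
by move=> u; apply: reg.
Qed.

End DimensionBound.

(** * Regular sequences along a filtration *)

Section WeaklyRegular.
Variable R : comNzRingType.
Implicit Types (I : {pred R}) (t b : nat -> R).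

Definition mod_seq t i I (u : R) : Prop :=
  exists b, u - \sum_(j < i) b j * t j \in I.

Definition weakly_regular t n I : Prop :=
  forall i u, (i < n)%N -> mod_seq t i I (t i * u) -> mod_seq t i I u.

(** The vanishing of the first Koszul homology (or Tor) of a regular sequence. *)
Lemma weakly_regular_syzygy t n I i b : ideal_closed I -> weakly_regular t n I ->
  (i <= n)%N -> \sum_(j < i) b j * t j \in I ->
  exists b', (forall j, b' j \in I) /\
    \sum_(j < i) b j * t j = \sum_(j < i) b' j * t j.
Proof.
move=> hI reg; elim: i b => [|i IH] b lei sumI.
  by exists (fun=> 0); rewrite !big_ord0; split=> // _; apply: ideal0.
have [|c cI] := reg i (b i) lei.
  exists (fun j => - b j); rewrite big_ord_recr /= in sumI.
  by under eq_bigr do rewrite mulNr; rewrite sumrN opprK mulrC addrC.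
set w := b i - _ in cI.
have bE : \sum_(j < i.+1) b j * t j
    = \sum_(j < i) (b j + c j * t i) * t j + w * t i.
  rewrite big_ord_recr /= /w mulrBl mulr_suml.
  under [in RHS]eq_bigr do rewrite mulrDl; rewrite big_split /=.
  have -> : \sum_(j < i) c j * t i * t j = \sum_(j < i) c j * t j * t i.
    by apply: eq_bigr => j _; ring.
  by ring.
have [|b' [b'I b'E]] := IH (fun j => b j + c j * t i) (ltnW lei).
  have -> : \sum_(j < i) (b j + c j * t i) * t j
    = \sum_(j < i.+1) b j * t j - w * t i by rewrite bE addrK.
  by apply: idealB => //; rewrite mulrC; apply: idealM.
exists (fun j => if (j < i)%N then b' j else w); split=> [j|]; first by case: ifP.
rewrite bE b'E big_ord_recr /= ltnn; congr (_ + _); apply: eq_bigr => j _.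
by rewrite ltn_ord.
Qed.

(** When the image of [I] under [phi] is generated by [phi r], the quotient
    of [I] by its part in the kernel of [phi] is a copy of the image of [phi], so a
    sequence that is regular modulo [I] and modulo the kernel is regular modulo
    the intersection. *)
Lemma weakly_regular_inter (D : idomainType) (phi : {rmorphism R -> D}) t n I r :
  ideal_closed I -> weakly_regular t n I -> weakly_regular t n (ker_pred phi) ->
  r \in I -> phi r != 0 ->
  (forall w, w \in I -> exists w', phi w = phi r * phi w') ->
  weakly_regular t n (fun u => (u \in I) && (phi u == 0)).
Proof.
move=> hI regI regk rI phir imI i u lti [b]; rewrite [X in X -> _]/=.
set I' : {pred R} := fun u => _.
have I'E x : (x \in I') = (x \in I) && (phi x == 0) by [].
rewrite I'E => /andP[bI /eqP b0].
have [|a aI] := regI i u lti; first by exists b.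
set w := u - _ in aI.
have uE : u = w + \sum_(j < i) a j * t j by rewrite /w subrK.
pose b1 j := b j - t i * a j.
have wE : t i * w - \sum_(j < i) b1 j * t j = t i * u - \sum_(j < i) b j * t j.
  have -> : \sum_(j < i) b1 j * t j
      = \sum_(j < i) b j * t j - t i * \sum_(j < i) a j * t j.
    rewrite mulr_sumr -sumrB; apply: eq_bigr => j _; rewrite /b1; ring.
  by rewrite /w; ring.
have [|b2 [b2I b2E]] := weakly_regular_syzygy (b := b1) hI regI (ltnW lti).
  have -> : \sum_(j < i) b1 j * t j
     = t i * w - (t i * u - \sum_(j < i) b j * t j) by rewrite -wE; ring.
  by apply: idealB => //; apply: idealM.
have [w' w'E] := imI w aI.
have [v vE] := choice (fun j => imI _ (b2I j)).
have [|d dE] := regk i w' lti.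
  exists v; rewrite ker_predE; apply/eqP/(mulfI phir); rewrite mulr0 -[RHS]b0 -wE b2E.
  rewrite !rmorphB !rmorphM w'E !rmorph_sum /= mulrBr mulrCA mulr_sumr.
  congr (_ - _); apply: eq_bigr => j _.
  by rewrite !rmorphM vE mulrA.
exists (fun j => a j + d j * r).
have -> : u - \sum_(j < i) (a j + d j * r) * t j = w - (\sum_(j < i) d j * t j) * r.
  have -> : \sum_(j < i) (a j + d j * r) * t j
      = \sum_(j < i) a j * t j + (\sum_(j < i) d j * t j) * r.
    by rewrite mulr_suml -big_split; apply: eq_bigr => j _ /=; ring.
  by rewrite /w; ring.
rewrite I'E idealB //=; last exact: idealM.
move: dE; rewrite ker_predE rmorphB => /eqP/subr0_eq dE.
by rewrite rmorphB rmorphM w'E dE mulrC subrr.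
Qed.

End WeaklyRegular.

(** As the leading coefficient of [p] is invertible, that of [u] is in [J], and the
    leading term of [u] can be subtracted. *)
Lemma poly_coef_ideal (B : comNzRingType) (J : {pred B}) (p u : {poly B}) (c : B) :
  ideal_closed J -> c * lead_coef p = 1 -> (forall k, (p * u)`_k \in J) ->
  forall k, u`_k \in J.
Proof.
move=> hJ cp; have [n leun] := ubnP (size u).
elim: n u leun => // n IH u; rewrite ltnS => leun puJ k.
have [u0|u0] := eqVneq u 0; first by rewrite u0 coef0; apply: ideal0.
have lu : lead_coef u \in J.
  rewrite -[lead_coef u]mul1r -cp -mulrA; apply: idealM => //.
  by rewrite mul_lead_coef; apply: puJ.
have [sk|sk] := eqVneq k (size u).-1; first by rewrite sk.
pose u' := u - lead_coef u *: 'X^((size u).-1).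
have u'E j : u'`_j = u`_j - lead_coef u * (j == (size u).-1)%:R.
  by rewrite coefB coefZ coefXn.
have -> : u`_k = u'`_k by rewrite u'E (negPf sk) mulr0 subr0.
apply: IH => [|j].
  apply: leq_trans leun; rewrite (@leq_ltn_trans (size u).-1) ?prednK ?size_poly_gt0 //.
  apply/leq_sizeP => j lej; rewrite u'E; have [->|ne] := eqVneq j (size u).-1.
    by rewrite mulr1 subrr.
  rewrite mulr0 subr0 nth_default // -(prednK (n := size u)) ?size_poly_gt0 //.
  by rewrite ltn_neqAle eq_sym ne.
rewrite mulrBr coefB -scalerAr coefZ; apply: idealB => //.
by rewrite mulrC; apply: idealM.
Qed.

Section VariablePowers.
Variables (K : fieldType) (T : finType).
Local Notation R := {mpoly K[#|T|]}.
Local Notation var := (vertex_var K).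

Definition poly_at (p : {poly K}) (x : R) : R := (map_poly (@mpolyC #|T| K) p).[x].

Lemma rmorph_poly_at (B : comNzRingType) (f : {rmorphism R -> B}) p x :
  f (poly_at p x) = (map_poly (f \o @mpolyC #|T| K) p).[f x].
Proof. by rewrite /poly_at -horner_map -map_poly_comp. Qed.

(** Polynomials in distinct variables form a regular sequence: [p_i] has
    an invertible leading coefficient as a polynomial in [z_i] over a ring that
    contains the previous [p_j (z_j)]. *)
Lemma variables_regular (p : nat -> {poly K}) (z : nat -> T) i u (b : nat -> R) :
  (forall j, p j != 0) -> (forall j, (j < i)%N -> z j != z i) ->
  poly_at (p i) (var (z i)) * u = \sum_(j < i) b j * poly_at (p j) (var (z j)) ->
  exists a : nat -> R, u = \sum_(j < i) a j * poly_at (p j) (var (z j)).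
Proof.
move=> p0 zi puE; set P := fun j => poly_at (p j) (var (z j)).
pose J : {pred R} := fun v => `[< exists a : nat -> R, v = \sum_(j < i) a j * P j >].
have hJ : ideal_closed J.
  split; first by apply/asboolP; exists (fun=> 0); rewrite big1 // => j _; rewrite mul0r.
  move=> a v w /asboolP[c ->] /asboolP[d ->]; apply/asboolP.
  exists (fun j => a * c j + d j); rewrite mulr_sumr -big_split /=.
  by apply: eq_bigr => j _; ring.
have JP j : (j < i)%N -> P j \in J.
  move=> ltj; apply/asboolP; exists (fun k => (k == j)%:R).
  rewrite (bigD1 (Ordinal ltj)) //= eqxx mul1r big1 ?addr0 // => k kj.
  by rewrite [k == j :> nat](negPf kj) mul0r.
pose C : {rmorphism K -> {poly R}} := polyC \o @mpolyC #|T| K.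
pose psi : {rmorphism R -> {poly R}} :=
  ev C (fun x => if x == z i then 'X else (var x)%:P).
have psiC c : psi c%:MP = C c by apply: evC.
have psi_var x : psi (var x) = if x == z i then 'X else (var x)%:P by apply: ev_var.
have psiP j : (j < i)%N -> psi (P j) = (P j)%:P.
  move=> ltj; rewrite /P (rmorph_poly_at (polyC : {rmorphism R -> {poly R}})).
  rewrite (rmorph_poly_at psi) psi_var (negPf (zi j ltj)).
  by congr (_.[_]); apply: eq_map_poly => c; exact: psiC.
have psi_i : psi (P i) = map_poly (@mpolyC #|T| K) (p i).
  rewrite /P (rmorph_poly_at psi) psi_var eqxx -[RHS]comp_polyXr /comp_poly.
  rewrite -map_poly_comp; congr (_.[_]); apply: eq_map_poly => c.
  exact: psiC.
have lead1 : (lead_coef (p i))^-1%:MP * lead_coef (psi (P i)) = 1.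
  rewrite psi_i lead_coef_map_inj ?mpolyC0 //; last exact: (can_inj (@mpolyCK #|T| K)).
  by rewrite -mpolyCM mulVf ?lead_coef_eq0.
have coefJ k : (psi (P i) * psi u)`_k \in J.
  rewrite -rmorphM puE rmorph_sum coef_sum; apply: ideal_sum => // j _.
  by rewrite rmorphM /= psiP // coefMC; apply: idealM => //; apply: JP.
have uJ : forall k, (psi u)`_k \in J := poly_coef_ideal hJ lead1 coefJ.
have -> : u = (psi u).[var (z i)].
  apply: (eq_rmorph_var (f := idfun) (g := horner_eval (var (z i)) \o psi)) => [c|x] /=.
    by rewrite psiC /horner_eval hornerC.
  rewrite psi_var /horner_eval; case: eqP => [->|_]; first by rewrite hornerX.
  by rewrite hornerC.
suff /asboolP : (psi u).[var (z i)] \in J by [].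
rewrite horner_coef; apply: ideal_sum => // k _.
by rewrite mulrC; apply: idealM.
Qed.

End VariablePowers.

(** * From a shelling to regular sequences *)

Section ShellingFiltration.
Variables (K : fieldType) (T : finType).
Local Notation R := {mpoly K[#|T|]}.
Local Notation var := (vertex_var K).
Local Notation restr H := (sub (fun=> 0 : K) (~: H)).

Lemma sub_setU (p : T -> K) (S S' : {set T}) u :
  sub p S (sub p S' u) = sub p (S :|: S') u.
Proof.
apply: (eq_rmorph_var (f := sub p S \o sub p S') (g := sub p (S :|: S'))) => [c|x] /=.
  by rewrite !subC.
rewrite !sub_var inE; case: (boolP (x \in S')) => xS'; last by rewrite sub_var orbF.
by rewrite subC orbT.
Qed.

Lemma dvd_variables (V : seq T) (x : R) : uniq V ->
  (forall v, v \in V -> sub (fun=> 0 : K) [set v] x = 0) ->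
  exists w, x = (\prod_(v <- V) var v) * w.
Proof.
elim: V x => [|v V IH] x /=; first by exists x; rewrite big_nil mul1r.
move=> /andP[vV uV] x0; have [a] := sub_residue (fun=> 0 : K) [set v] x.
rewrite x0 ?mem_head // subr0 big_set1 mpolyC0 subr0 => xE.
have [v' v'V|w wE] := IH (a v) uV; last first.
  by exists w; rewrite big_cons {1}xE {1}wE; ring.
have := x0 v'; rewrite inE v'V orbT => /(_ isT); rewrite xE rmorphM /= sub_var inE.
have /negPf-> : v != v' by apply: contraNneq vV => ->.
by move/eqP; rewrite mulf_eq0 (negPf (var_neq0 K v)) orbF => /eqP.
Qed.

Definition vanishing (s : seq {set T}) : {pred R} :=
  fun u => all (fun H => restr H u == 0) s.

Lemma vanishing_ideal s : ideal_closed (vanishing s).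
Proof.
split; first by apply/allP => H _; rewrite rmorph0.
move=> a u v /allP u0 /allP v0; apply/allP => H Hs.
by rewrite rmorphD rmorphM (eqP (u0 H Hs)) (eqP (v0 H Hs)) mulr0 addr0.
Qed.

(** Add the facets in the order of the shelling.  The polynomials vanishing on
    the facets before [H], restricted to [H], form a principal ideal: it is
    generated by the product of the [v] for which [H] without [v] lies in an
    earlier facet. *)
Lemma shelling_weakly_regular (s : seq {set T}) (n : nat) (t : nat -> R) :
  (forall i j, (i < j)%N -> (j < size s)%N ->
      exists2 v, v \in nth set0 s j :\: nth set0 s i &
      exists2 l, (l < j)%N & nth set0 s j :\: nth set0 s l = [set v]) ->
  (forall H, H \in s -> weakly_regular t n (ker_pred (restr H))) ->
  weakly_regular t n (vanishing s).
Proof.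
move=> shell regH; rewrite -(take_size s).
have := leqnn (size s); move: {1 3}(size s) => k.
elim: k => [|k IH] ltk; first by move=> i u _ _; exists (fun=> 0); rewrite take0.
have [r [rI rnz rdiv]] : exists r, [/\ r \in vanishing (take k s),
    restr (nth set0 s k) r != 0 & forall w, w \in vanishing (take k s) ->
    exists w', restr (nth set0 s k) w = restr (nth set0 s k) r * restr (nth set0 s k) w'].
  set H := nth set0 s k.
  pose V := [set v in H | [exists l : 'I_k, H :\: nth set0 s l == [set v]]].
  pose r := \prod_(v <- enum V) var v; exists r.
  have VH v : v \in V -> v \in H by rewrite inE => /andP[].
  have rE : restr H r = r.
    rewrite rmorph_prod; rewrite big_seq [RHS]big_seq; apply: eq_bigr => v.
    by rewrite mem_enum => /VH vH; rewrite /= sub_var inE vH.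
  have r0 : r != 0 by rewrite prodf_seq_neq0; apply/allP => v _; apply: var_neq0.
  split; last 1 first.
  - move=> w wI; have [||w' w'E] := @dvd_variables (enum V) (restr H w).
    + exact: enum_uniq.
    + move=> v; rewrite mem_enum inE => /andP[vH /existsP[l /eqP Hl]].
      have lks : (l < size (take k s))%N by rewrite size_takel ?(ltnW ltk).
      rewrite sub_setU.
      have /allP/(_ (nth set0 s l)) := wI.
      rewrite -[X in X \in _](nth_take set0 (ltn_ord l)) mem_nth // => /(_ isT)/eqP w0.
      rewrite -(@sub_sub _ _ _ (~: nth set0 s l)) ?w0 ?rmorph0 //.
      apply/subsetP => x; rewrite !inE => xl.
      have /setP/(_ x) := Hl; rewrite !inE xl /= => <-.
      by case: (x \in H).
    by exists w'; rewrite -[LHS](sub_sub _ _ (subxx (~: H))) w'E rmorphM /= rE.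
  - apply/allP => G /(nthP set0)[i]; rewrite size_takel ?(ltnW ltk) // => lti <-.
    rewrite nth_take //; have [v /setDP[vH vi] [l ltl Hl]] := shell i k lti ltk.
    rewrite /r (bigD1_seq v) ?enum_uniq //= ?mem_enum ?inE ?vH; last first.
      by apply/existsP; exists (Ordinal ltl); rewrite -/H Hl.
    by rewrite rmorphM /= sub_var inE vi mpolyC0 mul0r.
  by rewrite rE.
have regk := regH _ (mem_nth set0 ltk).
have := weakly_regular_inter (vanishing_ideal _) (IH (ltnW ltk)) regk rI rnz rdiv.
suff -> : (fun u => (u \in vanishing (take k s)) && (restr (nth set0 s k) u == 0))
   = vanishing (take k.+1 s) by [].
apply/funext => u; rewrite /vanishing (take_nth set0 ltk) all_rcons andbC.
by [].
Qed.

End ShellingFiltration.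

(** * Cohen-Macaulayness of the edge ring *)

Section AlgebraicResidues.
Variables (K : fieldType) (A : comNzRingType) (k : {rmorphism K -> A}).

(** By Zariski's lemma, the residue field is algebraic over [K]. *)
Lemma maximal_algebraic (a : seq A) (M : {pred A}) (x : A) :
  generates k a -> maximal_ideal M ->
  exists2 p : {poly K}, p != 0 & (map_poly k p).[x] \in M.
Proof.
move=> gen maxM; have [idM _] := maxM.
have [L [q [q_surj q_ker]]] := quotient_exists idM.
pose kq : {rmorphism K -> L} := q \o k.
have invL (z : L) : z != 0 -> exists w, z * w = 1.
  have [u <-] := q_surj z => u0.
  have [|v /q_ker] := @maximal_inverse _ M u maxM.
    by apply: contra_neqN u0 => /q_ker.
  by rewrite rmorphB rmorph1 rmorphM => /subr0_eq vu; exists (q v); rewrite mulrC -vu.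
have genL : generates kq (map q a).
  move=> S SK Sa SD SM z; have [u <-] := q_surj z.
  move: u; apply: gen => [b|y ya|u v|u v].
  - exact: SK.
  - by apply: Sa; apply: map_f.
  - by rewrite rmorphD; apply: SD.
  by rewrite rmorphM; apply: SM.
have [alg _] := zariski_gdomain erefl (fmorph_inj kq) invL genL.
have int z : integralOver kq z.
  move: z; apply: genL => [c|y ya|u v|u v].
  - exact: integral_id.
  - have [r r0 ry] := alg y ya.
    have -> : y = kq (lead_coef r)^-1 * (kq (lead_coef r) * y).
      by rewrite mulrA -rmorphM mulVf ?lead_coef_eq0 // rmorph1 mul1r.
    by apply: integral_mul; [apply: integral_id | apply: integral_lead_mul].
  - exact: integral_add.
  exact: integral_mul.
have [p monp /rootP px] := int (q x).
exists p; first exact: monic_neq0.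
by apply/q_ker; rewrite -horner_map -map_poly_comp.
Qed.

End AlgebraicResidues.

Section EdgeRing.
Variables (K : fieldType) (T : finType) (e : rel T).
Local Notation R := {mpoly K[#|T|]}.
Local Notation var := (vertex_var K).
Local Notation restr H := (sub (fun=> 0 : K) (~: H)).

Lemma polynomial_ring_dim : dim_le (@mpolyC #|T| K) #|T|.
Proof.
move=> t; have [m [c [c0 rel]]] :=
  algebraic_dependence (fun (_ : unit) j => t j) (ltnSn #|T|).
by exists m, c; split=> //; apply: rel tt.
Qed.

(** Write [K[H]] as a polynomial ring in [#|H|] variables for each facet [H]; a
    relation common to all facets is a relation in the edge ring. *)
Lemma edge_ring_dim (p : {rmorphism R -> edge_ring K e}) (n : nat) :
  irreflexive e -> (forall z, exists u, p u = z) ->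
  (forall u, p u = 0 <-> u \in edge_ideal K e) ->
  (forall H, maxset (independent e) H -> #|H| = n) ->
  dim_le (p \o @mpolyC #|T| K) n.
Proof.
move=> e_irr p_surj p_ker cardH t; have [u uE] := choice (fun j => p_surj (t j)).
pose rho (H : {set T}) : {rmorphism R -> {mpoly K[n]}} := ev (@mpolyC n K) (fun x =>
  if insub (index x (enum H)) is Some i then 'X_i else 0).
have [m [c [c0 rel]]] := algebraic_dependence (fun H j => rho H (u j)) (ltnSn n).
exists m, c; split=> //.
have -> : \sum_v (p \o @mpolyC #|T| K) (c v) * monomial t v
    = p (\sum_v (c v)%:MP * monomial u v).
  have -> : t = fun j => p (u j) by apply/funext => j; rewrite uE.
  by rewrite rmorph_sum; apply: eq_bigr => v _; rewrite rmorphM rmorph_monomial.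
apply/p_ker/edge_ideal_inter_max => // H fH.
pose beta : {rmorphism {mpoly K[n]} -> R} := mmap (@mpolyC #|T| K)
  (fun i : 'I_n => if [pick x in H | index x (enum H) == i] is Some x then var x else 0).
have betaE w : beta (rho H w) = restr H w.
  apply: (eq_rmorph_var (f := beta \o rho H) (g := restr H)) => [b|x] /=.
    by rewrite /rho evC /beta mmapC subC.
  rewrite /rho ev_var sub_var inE; case: insubP => [i lti iE|] /=.
    have xH : x \in H by rewrite -mem_enum -index_mem -cardE (cardH H fH).
    have {}iE : i = index x (enum H) :> nat by [].
    rewrite /beta mmapX mmap1U xH /=; case: pickP => [y /andP[yH /eqP yi]|/(_ x)].
      have xe : x \in enum H by rewrite mem_enum.
      have ye : y \in enum H by rewrite mem_enum.
      by rewrite -(nth_index x ye) yi iE nth_index.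
    by rewrite xH iE eqxx.
  rewrite -(cardH H fH) cardE index_mem mem_enum => ->.
  by rewrite rmorph0 mpolyC0.
have rhoC b : rho H b%:MP = b%:MP by apply: evC.
rewrite -betaE -[RHS](rmorph0 beta) -(rel H) (rmorph_sum (rho H)); apply: (congr1 beta).
by apply: eq_bigr => v _; rewrite rmorphM rmorph_monomial /= rhoC.
Qed.

Lemma edge_ring_generates (p : {rmorphism R -> edge_ring K e}) :
  (forall z, exists u, p u = z) ->
  generates (p \o @mpolyC #|T| K) [seq p (var x) | x <- enum T].
Proof.
move=> p_surj S SK Sv SD SM z; have [u <-] := p_surj z; move: u.
apply: mpoly_ring_ind => [c|x|u v|u v].
- exact: SK.
- by apply: Sv; apply: map_f; rewrite mem_enum.
- by rewrite rmorphD; apply: SD.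
by rewrite rmorphM; apply: SM.
Qed.

Lemma regular_seq_edge_ring (p : {rmorphism R -> edge_ring K e}) (s : seq R) :
  (forall z, exists u, p u = z) -> (forall u, p u = 0 <-> u \in edge_ideal K e) ->
  weakly_regular (nth 0 s) (size s) (edge_ideal K e) ->
  1 \notin ideal_gen (mem (map p s)) -> regular_seq (map p s).
Proof.
move=> p_surj p_ker reg prop; split=> // i x; rewrite size_map => lti.
have lei : (i <= size (map p s))%N by rewrite size_map ltnW.
have [u <-] := p_surj x; rewrite (nth_map 0) // -rmorphM.
have nthE (j : 'I_i) : (map p s)`_j = p s`_j.
  by rewrite (nth_map 0) // (ltn_trans (ltn_ord j)).
move=> /(ideal_gen_take_sumP _ lei)[a].
have [b bE] := choice (fun j => p_surj (a j)).
move=> aE; have [|c cI] := reg i u lti.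
  exists b; apply/p_ker; rewrite rmorphB aE rmorph_sum.
  under [X in X - _]eq_bigr do rewrite nthE.
  by under [X in _ - X]eq_bigr do rewrite rmorphM /= bE; rewrite subrr.
apply/(ideal_gen_take_sumP _ lei); exists (fun j => p (c j)).
move/p_ker: cI; rewrite rmorphB => /subr0_eq ->; rewrite rmorph_sum.
by apply: eq_bigr => j _; rewrite nthE rmorphM.
Qed.

End EdgeRing.

Section UnmixedBipartiteEdgeRing.
Variables (K : fieldType) (T : finType) (e : rel T) (A : {set T}).
Hypotheses (e_sym : ssrbool.symmetric e) (e_irr : irreflexive e).
Hypothesis (e_bip : forall x y, e x y -> (x \in A) != (y \in A)).
Hypothesis (e_iso : no_isolated e).
Hypothesis (e_unmixed : unmixed e).
Local Notation facet := (maxset (independent e)).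
Local Notation R := {mpoly K[#|T|]}.
Local Notation var := (vertex_var K).
Local Notation restr H := (sub (fun=> 0 : K) (~: H)).

(** A prime containing the edge ideal contains the variables of a vertex cover, so
    that its height is at least the size of this cover; and a chain of primes up to
    the ideal of [A] extends by [#|~: A|] steps, to a chain of length at most
    [#|T|]. *)
Lemma edge_ideal_height (g : nat) : ideal_height (edge_ideal K e) g -> g = #|A|.
Proof.
pose o : T -> K := fun=> 0; pose q : {rmorphism R -> R} := idfun.
have q_surj u : exists v, q v = u by exists u.
have closed S : coord_closed q o S by move=> u qu; rewrite -[u]/(q u) qu rmorph0.
have cardT : #|T| = (#|A| + #|A|)%N.
  by rewrite -(cardsC A) (card_Ac e_bip e_iso e_unmixed).
case=> [[P [pP IP [_ maxP]]] allP]; apply/eqP; rewrite eqn_leq; apply/andP; split.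
  have kill : {subset edge_ideal K e <= coord_prime q o A}.
    move=> u uI; rewrite -[u]/(q u) coord_primeE //; apply/eqP.
    rewrite subE; apply: (ev_kills_edges _ (H := ~: A)) uI.
      by have [] := maxsetP (facet_Ac e_bip e_iso).
    by move=> x; rewrite inE negbK => ->; rewrite mpolyC0.
  have chA := allP _ (coord_prime_prime q_surj (closed A)) kill.
  have := coord_chain q_surj (closed A) (enum_uniq (~: A)) _ chA.
  rewrite -cardE => /(_ _)/(prime_chain_le (@polynomial_ring_dim K T)).
  rewrite (card_Ac e_bip e_iso e_unmixed) cardT leq_add2r; apply.
  by move=> x; rewrite mem_enum inE.
pose C := [set x | var x \in P].
have hP : ideal_closed P by apply: idealr_ideal_closed; case: pP.
have cardC : (#|A| <= #|C|)%N.
  rewrite -(leq_add2r #|~: C|) cardsC cardT leq_add2l.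
  apply: (independent_card e_bip e_iso e_unmixed).
  apply/independentP => x y; rewrite !inE => xP yP; apply/negP => exy.
  by case/negP: yP; apply: prime_idealP xP => //; apply/IP/edge_in_ideal.
apply: leq_trans cardC _.
pose PC := coord_prime q o (set0 :|: [set x in enum C]).
have chC : prime_chain_to PC #|C|.
  rewrite cardE -[size _]add0n; apply: coord_chain => //; first exact: enum_uniq.
    by move=> x _; rewrite inE.
  exact/prime_chain0/coord_prime_prime.
have PCP : {subset PC <= P}.
  move=> u; rewrite -[u]/(q u) coord_primeE // => /eqP u0.
  have [a] := sub_residue o (set0 :|: [set x in enum C]) u.
  rewrite u0 subr0 -[q u]/u => ->; apply: ideal_sum => // x.
  rewrite !inE mem_enum inE /o mpolyC0 subr0 => xP.
  exact: idealM.
have [PPC|nPPC] := pselect {subset P <= PC}.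
  by apply: maxP; apply: prime_chain_to_eq chC => u; apply/idP/idP => [/PCP|/PPC].
by apply: ltnW; apply: maxP; apply: prime_chain_snoc chC pP PCP nPPC.
Qed.

Section Matching.
Variable f : T -> T.
Hypothesis (f_inj : {in A &, injective f}).
Hypothesis (fP : forall a, a \in A -> f a \in ~: A /\ e a (f a)).

Let fA := match_notin fP.
Let fE := match_edge fP.
Let f_surj := match_surj e_bip e_iso e_unmixed f_inj fP.
Let f_trans := match_trans e_sym e_irr e_bip e_iso e_unmixed f_inj fP.
Let nonadj := side_nonadjacent e_bip.

(** The vertices equivalent to [a] for the preorder span a complete bipartite
    graph with their partners, which is the link of the face made of the vertices
    strictly above [a] and the partners of those not above [a]. *)
Lemma CM_match_antisymmetric a b : CM_graph K e -> a \in A -> b \in A ->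
  e a (f b) -> e b (f a) -> a = b.
Proof.
move=> CM aA bA eab eba; apply/eqP/negPn/negP => ab.
pose up := [set c in A | e a (f c)].
pose C := [set c in A | e a (f c) && e c (f a)].
pose F := (up :\: C) :|: f @: (A :\: up).
pose H := up :|: f @: (A :\: up).
have iH : independent e H.
  have half c d : c \in up -> d \in A :\: up -> ~~ e c (f d).
    rewrite inE => /andP[cA eac] /setDP[dA]; rewrite inE dA /=; apply: contra.
    exact: f_trans eac.
  apply/independentP => x y /setUP[xU|/imsetP[c cU ->]] /setUP[yU|/imsetP[d dU ->]].
  - move: xU yU; rewrite !inE => /andP[xA _] /andP[yA _].
    by rewrite nonadj // xA yA.
  - exact: half.
  - by rewrite e_sym half.
  case/setDP: cU => cA _; case/setDP: dU => dA _.
  by rewrite nonadj // !fA.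
have FH : F \subset H by apply: setSU; apply: subsetDl.
have iF : independent e F by apply: independent_sub iH.
have inC c : (c \in C) = [&& c \in A, e a (f c) & e c (f a)] by rewrite inE.
have CA c : c \in C -> c \in A by rewrite inC => /and3P[].
have fF c : c \in A -> (f c \in F) = (c \notin up).
  move=> cA; rewrite inE [f c \in up :\: C]inE [f c \in up]inE fA // andbF /=.
  apply/imsetP/idP => [[d /setDP[dA dU] /f_inj-> //]|cU].
  by exists c => //; rewrite inE cU.
have AF c : c \in A -> (c \in F) = (c \in up) && (c \notin C).
  move=> cA; rewrite inE [c \in _ :\: _]inE andbC; apply/orb_idr.
  by move=> /imsetP[d /setDP[dA _] cE]; rewrite cE fA in cA.
have CU c : c \in C -> c \in up by rewrite inC inE => /and3P[-> ->].
have link : C :|: f @: C = link_vertices e F.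
  apply/setP => v; apply/idP/idP.
    case/setUP => [vC|/imsetP[c cC ->]]; rewrite inE.
      have vA := CA v vC; rewrite AF // vC andbF /=; apply/forall_inP => x.
      case/setUP => [/setDP[xU _]|/imsetP[d /setDP[dA dU] ->]].
        by rewrite nonadj //; move: xU; rewrite inE vA => /andP[->].
      apply: contra dU => evd; rewrite inE dA /=.
      by move: vC; rewrite inC => /and3P[_ eav _]; apply: f_trans eav evd.
    have cA := CA c cC; rewrite fF // CU //=; apply/forall_inP => x.
    case/setUP => [/setDP[xU xC]|/imsetP[d /setDP[dA dU] ->]]; last first.
      by rewrite nonadj // !fA.
    move: xU; rewrite inE => /andP[xA eax]; rewrite e_sym; apply: contra xC => exc.
    rewrite inC xA eax /=; move: cC; rewrite inC => /and3P[_ _ eca].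
    exact: f_trans exc eca.
  rewrite inE => /andP[vF /forall_inP vN].
  have [vA|/f_surj[c cA vE]] := boolP (v \in A).
    have vU : v \in up.
      by apply: contraT => vU; have := vN (f v); rewrite fF // vU fE // => /(_ isT).
    by move: vF; rewrite AF // vU /= negbK => vC; rewrite inE vC.
  rewrite vE fF // negbK in vF; rewrite inE; apply/orP; right; rewrite vE imset_f //.
  apply: contraT => cC; have := vN c; rewrite AF // vF cC vE e_sym fE // => /(_ isT).
  by [].
have aC : a \in C by rewrite inC aA fE.
have bC : b \in C by rewrite inC bA eab eba.
have across x y : x \in C -> y \in f @: C -> e x y.
  move=> xC /imsetP[c cC ->]; move: xC cC; rewrite !inC.
  by move=> /and3P[xA _ exa] /and3P[cA eac _]; apply: f_trans exa eac.
have := CM_link_connected e_sym e_irr CM iF link aC (imset_f f aC) across iH FH.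
apply/negP; rewrite -ltnNge.
have -> : H = F :|: C.
  apply/setP => x; rewrite !in_setU in_setD; case: (boolP (x \in C)) => /= [/CU->|_] //.
    by rewrite orbT.
  by rewrite orbF.
rewrite cardsU disjoint_setI0.
  rewrite cards0 subn0 -addn2 leq_add2l (cardsD1 a C) aC (cardsD1 b) !inE eq_sym ab.
  by rewrite -inC bC.
apply/pred0P => x /=; apply/negP => /andP[xF xC].
by move: xF; rewrite AF ?CA // xC andbF.
Qed.

Lemma CM_shellable : CM_graph K e ->
  shellable (pure_skeleton (indep_complex e) #|A|).
Proof.
move=> CM.
have [|s [us ms shell]] :=
    facets_shelling e_sym e_irr e_bip e_iso e_unmixed f_inj fP.
  by move=> a b; apply: CM_match_antisymmetric.
exists s; split=> // H.
by rewrite facets_skeleton // inE ms.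
Qed.

Definition pair_sequence (pp : T -> {poly K}) : seq R :=
  [seq poly_at (pp a) (var a + var (f a)) | a <- enum A].

(** A facet contains exactly one of [a] and [f a], so [var a + var (f a)] restricts
    to a variable on it, different ones for different [a]. *)
Lemma facet_weakly_regular (pp : T -> {poly K}) (H : {set T}) : facet H ->
  (forall a, pp a != 0) ->
  weakly_regular (nth 0 (pair_sequence pp)) (size (pair_sequence pp))
    (ker_pred (restr H)).
Proof.
move=> fH pp0 i u; rewrite size_map => lti.
have [x0 _] : exists x0, x0 \in enum A.
  by case: (enum A) lti => // x0 l _; exists x0; rewrite mem_head.
pose a j := nth x0 (enum A) j; pose z j := if a j \in H then a j else f (a j).
have aA j : (j <= i)%N -> a j \in A.
  by move=> lej; rewrite -mem_enum mem_nth // (leq_ltn_trans lej).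
have tE j : (j <= i)%N -> restr H (pair_sequence pp)`_j = poly_at (pp (a j)) (var (z j)).
  move=> lej; rewrite (nth_map x0) ?(leq_ltn_trans lej) // rmorph_poly_at.
  rewrite rmorphD /= !sub_var !inE -/(a j).
  rewrite (facet_match e_bip e_iso e_unmixed f_inj fP) ?aA // negbK /z.
  have -> : (if a j \notin H then (0 : K)%:MP else var (a j)) +
            (if a j \in H then 0%:MP else var (f (a j)))
          = var (if a j \in H then a j else f (a j)).
    by case: (a j \in H) => /=; rewrite mpolyC0 ?addr0 ?add0r.
  by congr (_.[_]); apply: eq_map_poly => c /=; rewrite subC.
have zi j : (j < i)%N -> z j != z i.
  move=> ltj; have aji : a j != a i.
    by rewrite nth_uniq ?enum_uniq ?(ltn_trans ltj) // ltn_eqF.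
  have aj := aA j (ltnW ltj); have ai := aA i (leqnn i).
  rewrite /z; case: ifP => _; case: ifP => _ //.
  - by apply: contraTneq aj => ->; rewrite fA.
  - by apply: contraTneq ai => <-; rewrite fA.
  by apply: contra aji => /eqP/f_inj->.
have idem w : restr H (restr H w) = restr H w by apply: sub_sub.
case=> b; rewrite ker_predE rmorphB rmorphM rmorph_sum tE // => /eqP/subr0_eq uE.
have [|c cE] := @variables_regular K T (fun j => pp (a j)) z i (restr H u)
    (fun j => restr H (b j)) (fun j => pp0 _) zi.
  by rewrite uE; apply: eq_bigr => j _; rewrite rmorphM tE // ltnW.
exists (fun j => restr H (c j)); rewrite ker_predE rmorphB rmorph_sum subr_eq0.
rewrite -idem {1}cE rmorph_sum; apply/eqP/eq_bigr => j _.
by rewrite !rmorphM idem -tE ?idem // ltnW.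
Qed.

(** For each maximal ideal [M], there are polynomials [pp a] in one variable whose
    values at [var a + var (f a)] lie in [M].  These values form a regular sequence
    of length [#|A|], which also bounds the height of [M] from below; [#|A|] bounds
    both from above, as the dimension of the edge ring. *)
Lemma shelling_CM : shellable (pure_skeleton (indep_complex e) #|A|) -> CM_graph K e.
Proof.
case=> s [_ sE shell] M maxM; have [idM _] := maxM.
have ms H : (H \in s) = facet H by rewrite sE facets_skeleton // inE.
have [p [p_surj p_ker]] := edge_ring_map K e.
have dimA := edge_ring_dim e_irr p_surj p_ker (facet_card e_bip e_iso e_unmixed).
have alg a := maximal_algebraic (p (var a + var (f a))) (edge_ring_generates p_surj) maxM.
have [pp ppE] := @choice _ _ (fun a (r : {poly K}) => r != 0 /\
    (map_poly (p \o @mpolyC #|T| K) r).[p (var a + var (f a))] \in M)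
    (fun a => let: ex_intro2 r r0 rM := alg a in ex_intro _ r (conj r0 rM)).
pose t := pair_sequence pp.
have IE : edge_ideal K e = vanishing s.
  apply/funext => u; apply/idP/idP => [uI|/allP u0].
    apply/allP => H; rewrite ms => fH; apply/eqP; rewrite subE.
    apply: (ev_kills_edges _ (maxsetp fH)) uI => x xH.
    by rewrite inE xH mpolyC0.
  by apply: edge_ideal_inter_max => // H fH; apply/eqP/u0; rewrite ms.
have tM : {subset map p t <= M}.
  move=> _ /mapP[_ /mapP[a _ ->] ->]; rewrite rmorph_poly_at.
  by have [] := ppE a.
have reg : regular_seq (map p t).
  apply: regular_seq_edge_ring => //.
    rewrite IE; apply: shelling_weakly_regular shell _ => H; rewrite ms => fH.
    by apply: facet_weakly_regular => // a; have [] := ppE a.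
  case: (idM) => _ + _; apply: contra; apply: ideal_gen_min => //.
  exact: idealr_ideal_closed.
have sizeA : size (map p t) = #|A| by rewrite !size_map -cardE.
have pM := maximal_prime maxM.
exists #|A|; split; split.
- by rewrite -sizeA; apply: regular_seq_prime_chain.
- by move=> k; apply: prime_chain_le dimA.
- by exists (map p t).
by move=> k [s' [<- reg' _]]; apply: regular_seq_le dimA reg'.
Qed.

End Matching.
End UnmixedBipartiteEdgeRing.

Theorem corollary4p5 (K : fieldType) (T : finType) (e : rel T)
    (e_sym : ssrbool.symmetric e) (e_irr : irreflexive e)
    (e_bip : bipartite e) (e_iso : no_isolated e)
    (g : nat) (hg : ideal_height (edge_ideal K e) g) :
  CM_graph K e <-> (shellable (pure_skeleton (indep_complex e) g) /\ unmixed e).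
Proof.
case: e_bip => A bip; split=> [CM|[shell um]].
  have um := CM_unmixed e_sym e_irr CM; split=> //.
  have [f [f_inj fP]] := perfect_matching e_sym bip e_iso um.
  by rewrite (edge_ideal_height bip e_iso um hg); apply: CM_shellable f_inj fP CM.
have [f [f_inj fP]] := perfect_matching e_sym bip e_iso um.
rewrite (edge_ideal_height bip e_iso um hg) in shell.
exact: shelling_CM f_inj fP shell.
Qed.
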